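(* Let $K$ be an origin-symmetric convex body in $\mathbb S^2_+$ with $K\neq\mathbb S^2_+$. Then $$\int_{S^1} \mathrm{vol}(K\cap\xi^\perp)^2\, d\xi\le 16\int_0^{\pi/2}\arctan^2\Big(\frac{\tan(\mathrm{vol}(K)/4)}{\cos\theta}\Big)\,d\theta,$$ with equality if and only if $K$ is a lune.
   Context: $\mathbb S^2_+$ is the closed upper hemisphere of the unit sphere in $\mathbb R^3$, with its geodesic distance $\mathrm d$; the origin $o$ is the center (pole) of the hemisphere. A set $A\subset\mathbb S^2_+$ is convex if it is the intersection of $\mathbb S^2_+$ with a convex cone in $\mathbb R^3$ with vertex at the origin of $\mathbb R^3$; a convex body is a closed convex set with nonempty interior. $S^1$ is the unit circle in the tangent plane $T_o\mathbb S^2_+$, with arc-length measure $d\xi$ of total mass $2\pi$. The radial function $\rho_K(\xi)$ is the supremum of $\mathrm d(x,o)$ over $x\in K$ on the geodesic ray from $o$ in direction $\xi\in S^1$; $K$ is origin-symmetric if it is symmetric about $o$, i.e. $\rho_K(\xi)=\rho_K(-\xi)$ for all $\xi$. For $\xi\in S^1$, $\xi^\perp$ is the geodesic line of $\mathbb S^2_+$ through $o$ with normal $\xi$ at $o$. $\mathrm{vol}$ is spherical area (for subsets of $\mathbb S^2_+$) or length (for subsets of $\xi^\perp$). Geodesic lines of $\mathbb S^2_+$ are intersections of $\mathbb S^2_+$ with great circles meeting its interior; two geodesic lines are parallel if they never meet in the interior of $\mathbb S^2_+$, i.e. they meet only on the boundary of $\mathbb S^2_+$. A lune is a region in $\mathbb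 S^2_+$ whose boundary consists of two parallel geodesic lines. *)

(* Defs.v *)
From HB Require Import structures.
From mathcomp Require Import all_boot all_order all_algebra.
From mathcomp Require Import all_classical all_reals all_analysis.

Set Implicit Arguments.
Unset Strict Implicit.
Unset Printing Implicit Defensive.

Import Order.TTheory GRing.Theory Num.Theory.
Import numFieldNormedType.Exports.

Local Open Scope classical_set_scope.
Local Open Scope ring_scope.

Section Hemisphere.
Context {R : realType}.
Implicit Types (x y n xi v : 'rV[R]_3) (A K L : set 'rV[R]_3).

Definition dot x y : R := \sum_(i < 3) x 0 i * y 0 i.

Definition vec3 (a b c : R) : 'rV[R]_3 := \row_(i < 3) [:: a; b; c]`_i.

(* The norm that the library puts on 'rV[R]_3 is the sup norm; it is used here
   only through the topology. *)
Definition sphere : set 'rV[R]_3 := [set x | dot x x = 1].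

Definition pole : 'rV[R]_3 := vec3 0 0 1.

Definition hemisphere : set 'rV[R]_3 := [set x | sphere x /\ 0 <= dot x pole].

(* Interior and boundary are taken in the topology of the whole sphere, so that
   [sph_interior hemisphere] is the open hemisphere. *)
Definition sph_interior A : set 'rV[R]_3 :=
  [set x | sphere x /\ within sphere (nbhs x) A].

Definition sph_boundary A : set 'rV[R]_3 :=
  closure A `&` closure (sphere `\` A).

Definition sdist x y : R := acos (dot x y).

(* Whether the vertex belongs to the cone is irrelevant to its trace on the
   sphere. *)
Definition convex_cone (C : set 'rV[R]_3) : Prop :=
  convex_set C /\ (forall (t : R) x, 0 < t -> C x -> C (t *: x)).

Definition sph_convex A : Prop :=
  exists2 C, convex_cone C & A = hemisphere `&` C.

Definition convex_body K : Prop :=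
  [/\ sph_convex K, closed K & sph_interior K !=set0].

(* The unit circle in the tangent plane at the pole, realised as a plane of
   R^3. *)
Definition tangent_circle : set 'rV[R]_3 :=
  [set xi | sphere xi /\ dot xi pole = 0].

Definition tangent_dir (phi : R) : 'rV[R]_3 := vec3 (cos phi) (sin phi) 0.

Definition circle_integral (f : 'rV[R]_3 -> \bar R) : \bar R :=
  (\int[lebesgue_measure]_(phi in `[0%R, (2 * pi)%R]) f (tangent_dir phi))%E.

(* Unit-speed geodesic of the sphere issued from the pole. *)
Definition geod xi (t : R) : 'rV[R]_3 := cos t *: pole + sin t *: xi.

Definition geod_ray xi : set 'rV[R]_3 := geod xi @` `[0, pi / 2].

(* [sup] is 0 on the empty set: this is the value on rays that miss K. *)
Definition radial K xi : R :=
  sup [set sdist x pole | x in K `&` geod_ray xi].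

Definition origin_symmetric K : Prop :=
  forall xi, tangent_circle xi -> radial K xi = radial K (- xi).

Definition perp xi : set 'rV[R]_3 := [set x | hemisphere x /\ dot x xi = 0].

Definition quarter_turn v : 'rV[R]_3 := vec3 (- v 0 1) (v 0 0) 0.

(* Length of a subset of [perp xi], for xi in the tangent circle:
   t |-> geod (quarter_turn xi) t, for t in [-pi/2, pi/2], is the arc-length
   parametrisation of [perp xi]. *)
Definition line_length xi A : \bar R :=
  lebesgue_measure
    [set t : R | - (pi / 2) <= t <= pi / 2 /\ A (geod (quarter_turn xi) t)].

(* Spherical area in geodesic polar coordinates (r, xi) about the pole, where
   the area element is sin r dr dxi. *)
Definition area A : \bar R :=
  circle_integral (fun xi =>
    \int[lebesgue_measure]_(r in `[0%R, (pi / 2)%R])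
      (sin r * \1_A (geod xi r))%:E)%E.

Definition geod_line L : Prop :=
  exists n, [/\ n != 0, L = hemisphere `&` [set x | dot x n = 0]
              & L `&` sph_interior hemisphere !=set0].

Definition parallel_lines L L' : Prop :=
  L `&` L' `&` sph_interior hemisphere = set0.

(* Two distinct great half-circles with the same endpoints on the equator cut
   the sphere into two components, only one of which lies in the hemisphere;
   so these conditions leave only the closed region between them. *)
Definition lune K : Prop :=
  [/\ K `<=` hemisphere, closed K, sph_interior K !=set0 &
      exists L L', [/\ geod_line L, geod_line L', parallel_lines L L' &
                       sph_boundary K = L `|` L']].

End Hemisphere.

(* Main.v *)
Require Import Defs.
From mathcomp Require Import all_boot all_order all_algebra.
From mathcomp Require Import all_classical all_reals all_analysis.
From mathcomp Require Import measurable_realfun.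
From mathcomp Require Import ring lra.

(** Project the hemisphere from the center of the sphere to the tangent plane at
    the pole. The body becomes a symmetric convex set, the cotangent [g] of its
    radial function [rho] is the gauge of this set on the unit circle, and lunes
    symmetric about the pole become strips, for which [g] is [M * |cos|] in
    angles counted from the normal.

    Both sides of the inequality are integrals of functions of [rho] over the
    circle: the area is the integral of [1 - cos rho], and the left-hand side is
    the integral of [4 * rho ^ 2]. The square of [rho] is a convex function of
    [1 - cos rho], with derivative [2 * rho / sin rho]. It is therefore enough
    to show that, among bodies of given area, the distribution of [rho] is the
    most spread out for the lune.

    Let [M] be the maximum of [g]. Sublinearity of the gauge says that
    [g = M * cos f] for a 1-Lipschitz function [f] of the angle with values
    between 0 and [pi / 2] ([slope_angle_lipschitz]), which vanishes in the two
    directions where [g] is maximal. Two consequences follow. The body lies in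
    the strip of parameter [M], so that the lune with the same area is a strip
    of parameter [M'] with [M <= M'] ([norm_cos_le]). And the length of the set
    of directions where [f >= c] decreases, as long as it is positive, at least
    as fast as for a strip ([level_length_drop]). As functions of [r], the
    lengths of the sets of directions where [rho >= r] for the body and for the
    lune hence cross only once ([single_crossing]): the one of the body is the
    larger below some radius [rs] and the smaller above. Integrated by layers
    ([layer_cake]), the square and the area have the densities [2 * r] and
    [sin r] with respect to [r]; subtracting the second, multiplied by
    [2 * rs / sin rs], from the first leaves a density which changes sign at
    [rs], as does the difference of the two lengths, and the inequality follows
    ([strip_majorization]). It is strict if [M < M'], because then the lune
    loses directions at radii where the body still has all of them. If
    [M = M'], the body and the strip containing it have the same area, and they
    coincide.

    For the equality case one has to recognise lunes. A strip is a lune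
    ([strip_lune]). Conversely, the boundary point of a lune nearest to the pole
    is on one of the two bounding lines; this line lies in the body, hence in
    the strip around it, and touches the boundary of the strip, so that it is a
    side of the strip; by symmetry the body is the whole strip
    ([lune_strip]). *)

Import Order.TTheory GRing.Theory Num.Theory.
Import numFieldNormedType.Exports.

Local Open Scope classical_set_scope.
Local Open Scope ring_scope.

Set Implicit Arguments.
Unset Strict Implicit.
Unset Printing Implicit Defensive.

(** * Trigonometry of strips *)

Section Trigonometry.
Context {R : realType}.
Implicit Types (a b c r x y M : R).

Lemma pihalf_gt0 : 0 < pi / 2 :> R.
Proof. by rewrite divr_gt0 ?pi_gt0. Qed.

Lemma pi_split : pi = pi / 2 + pi / 2 :> R.
Proof. by rewrite -splitr. Qed.

Lemma sin_ge0_pihalf x : 0 <= x <= pi / 2 -> 0 <= sin x.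
Proof.
move=> /andP[x0 x1]; apply: sin_ge0_pi; rewrite x0 /=.
have := @pihalf_gt0; have := pi_split; lra.
Qed.

Lemma sin_gt0_pihalfW x : 0 < x <= pi / 2 -> 0 < sin x.
Proof.
move=> /andP[x0 x1]; apply: sin_gt0_pi; rewrite x0 /=.
have := @pihalf_gt0; have := pi_split; lra.
Qed.

Lemma cos_ge0_pihalfW x : 0 <= x <= pi / 2 -> 0 <= cos x.
Proof.
move=> /andP[x0 x1]; apply: cos_ge0_pihalf; rewrite x1 andbT.
have := @pihalf_gt0; lra.
Qed.

Lemma ler_cos_pihalf x y : 0 <= x <= pi / 2 -> 0 <= y <= pi / 2 ->
  (cos x <= cos y) = (y <= x).
Proof.
move=> /andP[x0 x1] /andP[y0 y1].
have h := @pihalf_gt0; have p := pi_split.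
by rewrite !leNgt ltr_cos // in_itv /=; apply/andP; split; lra.
Qed.

Lemma cos_pihalfB x : cos (pi / 2 - x) = sin x.
Proof. by rewrite -opprB cosN cosBpihalf. Qed.

Lemma sin_pihalfB x : sin (pi / 2 - x) = cos x.
Proof. by rewrite -opprB sinN sinBpihalf opprK. Qed.

(** Concavity of the sine: both increments are governed by the mean value
    theorem and the cosine is decreasing. *)
Lemma sinc_lt a b : 0 < a -> a < b -> b <= pi / 2 -> a * sin b < b * sin a.
Proof.
move=> a0 ab b1.
have dsin (z : R) : is_derive z (1 : R) (@sin R) (cos z) by exact: is_derive_sin.
have csin z1 z2 : {within `[z1, z2], continuous (@sin R)}.
  by apply: continuous_subspaceT => z; exact: continuous_sin.
have [u] := @MVT _ (@sin R) cos 0 a a0 (fun z _ => dsin z) (csin _ _).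
rewrite in_itv /= sin0 !subr0 => /andP[u0 ua] sa.
have [v] := @MVT _ (@sin R) cos a b ab (fun z _ => dsin z) (csin _ _).
rewrite in_itv /= => /andP[va vb] sb.
have uv : cos v < cos u.
  rewrite ltNge ler_cos_pihalf -?ltNge; lra.
have -> : sin b = sin a + cos v * (b - a) by lra.
rewrite sa.
have : 0 < a * (b - a) * (cos u - cos v) by rewrite !mulr_gt0 // subr_gt0.
lra.
Qed.

Lemma sinc_le a b : 0 <= a -> a <= b -> b <= pi / 2 -> a * sin b <= b * sin a.
Proof.
rewrite le_eqVlt => /predU1P[<-|a0]; first by rewrite sin0 mul0r mulr0.
rewrite le_eqVlt => /predU1P[->//|ab] b1.
by apply/ltW/sinc_lt.
Qed.

(** Gnomonic projection from the center of the sphere maps the region between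
    two parallel geodesic lines symmetric about the pole to a planar strip; if
    its half-width is [1 / M], this is the distance from the pole to its
    boundary in a direction at angle [c] to the normal of the strip. The
    arctangent of the inverse distance covers the directions parallel to the
    strip, where the distance is [pi / 2]. *)
Definition strip_radius M c := pi / 2 - atan (M * cos c).

Lemma strip_radius_gt0 M c : 0 < strip_radius M c.
Proof. by rewrite subr_gt0 atan_ltpi2. Qed.

Lemma strip_radius_le M c : 0 <= M -> 0 <= cos c -> strip_radius M c <= pi / 2.
Proof.
move=> M0 c0; rewrite lerBlDr lerDl -(@atan0 R); apply: le_atan.
exact: mulr_ge0.
Qed.

Lemma strip_radius_geE M c r : 0 <= r <= pi / 2 ->
  (r <= strip_radius M c) = (M * cos c * sin r <= cos r).
Proof.
move=> /andP[]; rewrite le_eqVlt => /predU1P[<- _|r0 r1].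
  by rewrite sin0 cos0 mulr0 ler01 ltW // strip_radius_gt0.
have s0 : 0 < sin r by apply: sin_gt0_pihalfW; rewrite r0.
rewrite -ler_pdivlMr // /strip_radius lerBrDr addrC -lerBrDr.
have -> : cos r / sin r = tan (pi / 2 - r) by rewrite /tan sin_pihalfB cos_pihalfB.
have h := @pihalf_gt0.
rewrite -[in RHS](atanK (M * cos c)) !leNgt ltr_tan // in_itv /=.
- by apply/andP; split; lra.
- by rewrite atan_gtNpi2 atan_ltpi2.
Qed.

Lemma cos_strip_radius M c : cos (strip_radius M c) = sin (atan (M * cos c)).
Proof. exact: cos_pihalfB. Qed.

Lemma continuous_strip_radius M (f : R -> R) : continuous f ->
  continuous (fun x => strip_radius M (f x)).
Proof.
move=> cf x; apply: cvgB; first exact: cvg_cst.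
apply: (@continuous_comp _ _ _ (fun x => M * cos (f x)) (@atan R)); last first.
  exact: continuous_atan.
apply: cvgM; first exact: cvg_cst.
by apply: (@continuous_comp _ _ _ f (@cos R)); [exact: cf|exact: continuous_cos].
Qed.

Lemma continuous_1mcos (f : R -> R) : continuous f ->
  continuous (fun x => 1 - cos (f x)).
Proof.
move=> cf x; apply: cvgB; first exact: cvg_cst.
by apply: (@continuous_comp _ _ _ f (@cos R)); [exact: cf|exact: continuous_cos].
Qed.

Lemma continuous_sqr (f : R -> R) : continuous f ->
  continuous (fun x => (f x) ^+ 2).
Proof. by move=> cf x; apply: cvgM; exact: cf. Qed.

Lemma lipschitz1_continuous (f : R -> R) :
  (forall x y, `|f x - f y| <= `|x - y|) -> continuous f.
Proof.
move=> lf x; apply/cvgrPdist_le => /= e e0; near=> y.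
apply: le_trans (lf _ _) _; near: y.
by apply: (@cvgr_dist_le _ _ _ _ _ id x) => //; exact: cvg_id.
Unshelve. all: by end_near. Qed.

End Trigonometry.

(** * Integrals of continuous functions *)

Section ContinuousIntegrals.
Context {R : realType}.
Implicit Types (f g : R -> R) (a b c T : R).
Notation mu := (@lebesgue_measure R).

Lemma continuous_integrable f a b : continuous f ->
  mu.-integrable `[a, b] (EFin \o f).
Proof.
move=> cf; apply: continuous_compact_integrable; first exact: segment_compact.
exact: continuous_subspaceT.
Qed.

Lemma EFin_integral f a b : continuous f ->
  (\int[mu]_(x in `[a, b]) (f x)%:E)%E = (\int[mu]_(x in `[a, b]) f x)%:E.
Proof.
move=> cf; rewrite /Rintegral fineK //; apply: integrable_fin_num => //.
exact: continuous_integrable.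
Qed.

Lemma le_integral_continuous f g a b : continuous f -> continuous g ->
  (forall x, a <= x <= b -> f x <= g x) ->
  \int[mu]_(x in `[a, b]) f x <= \int[mu]_(x in `[a, b]) g x.
Proof.
move=> cf cg fg; apply: le_Rintegral => //; exact: continuous_integrable.
Qed.

Lemma integral_split f a b c : a <= b -> b <= c -> continuous f ->
  \int[mu]_(x in `[a, c]) f x =
  \int[mu]_(x in `[a, b]) f x + \int[mu]_(x in `[b, c]) f x.
Proof.
move=> ab bc cf.
have := @Rintegral_itvB R f (BLeft a) (BRight c) b (continuous_integrable _ _ cf).
rewrite !bnd_simp => /(_ ab bc) => h.
rewrite -(@Rintegral_itv_obnd_cbnd _ b) -?h ?subrKC // ?addrC ?subrK //.
apply: integrableS (continuous_integrable b c cf) => //.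
by apply: subset_itvr; rewrite bnd_simp.
Qed.

Lemma integral_shift f a b c : a <= b -> continuous f ->
  \int[mu]_(x in `[a + c, b + c]) f x = \int[mu]_(x in `[a, b]) f (x + c).
Proof.
move=> ab cf; rewrite /Rintegral; congr fine.
have D : derive1 (fun x : R => x + c) = cst (1 : R).
  by apply/funext => z; rewrite derive1E derive_val addr0.
have cD (z : R) : {for z, continuous (fun x : R => x + c)}.
  by apply: cvgD; [exact: cvg_id|exact: cvg_cst].
rewrite (@integration_by_substitution_increasing R (fun x => x + c) f) //.
- by apply: eq_integral => x _ /=; rewrite /= D /= mulr1.
- by move=> x y _ _ xy; rewrite ltrD2r.
- by rewrite D => x _; exact: cvg_cst.
- by rewrite D; apply/cvg_ex; exists 1; exact: cvg_cst.
- by rewrite D; apply/cvg_ex; exists 1; exact: cvg_cst.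
- split.
  + by move=> x _; apply: derivableD => //; exact: derivable_cst.
  + by apply: cvg_at_right_filter; exact: cD.
  + by apply: cvg_at_left_filter; exact: cD.
- exact: continuous_subspaceT.
Qed.

Lemma integral_reflect f a b : a <= b -> continuous f ->
  \int[mu]_(x in `[- b, - a]) f x = \int[mu]_(x in `[a, b]) f (- x).
Proof.
move=> ab cf; rewrite /Rintegral; congr fine.
by rewrite integration_by_substitution_oppr //; exact: continuous_subspaceT.
Qed.

Lemma integral_FTC f F a b : a <= b -> continuous f ->
  (forall x : R, is_derive x (1 : R) F (f x)) ->
  \int[mu]_(x in `[a, b]) f x = F b - F a.
Proof.
rewrite le_eqVlt => /predU1P[<- _ _|ab cf dF].
  by rewrite set_itv1 Rintegral_set1 subrr.
have cF : continuous F.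
  by move=> x; apply/differentiable_continuous/derivable1_diffP; have [] := dF x.
rewrite /Rintegral (@continuous_FTC2 R f F a b) //.
- exact: continuous_subspaceT.
- split.
  + by move=> x _; have [] := dF x.
  + by apply: cvg_at_right_filter; exact: cF.
  + by apply: cvg_at_left_filter; exact: cF.
- by move=> x _; rewrite derive1E; have [_] := dF x.
Qed.

Lemma eq_continuous_integral f g a b : a < b -> continuous f -> continuous g ->
  (forall x, a <= x <= b -> f x <= g x) ->
  \int[mu]_(x in `[a, b]) f x = \int[mu]_(x in `[a, b]) g x ->
  forall x, a <= x <= b -> f x = g x.
Proof.
move=> ab cf cg fg eI x /andP[ax xb]; apply/eqP; rewrite eq_le fg ?ax //=.
rewrite leNgt; apply/negP => fgx.
pose h y := g y - f y.
have ch : continuous h by move=> y; apply: cvgB; [exact: cg|exact: cf].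
have h0 : 0 < h x by rewrite subr_gt0.
(* an interval around x on which the gap stays above half of its value at x *)
have /cvgrPdist_lt/(_ (h x / 2)) : h @ x --> h x by exact: ch.
rewrite divr_gt0 // => /(_ isT)/nbhs_ballP[d /= d0 hd].
have hdx y : `|x - y| < d -> h x / 2 <= h y.
  move=> xy; have /= := hd _ xy; rewrite ltr_norml => /andP[_]; lra.
pose l := Num.max a (x - d / 2); pose r := Num.min b (x + d / 2).
have lr : l < r.
  by rewrite /l /r lt_min !gt_max; apply/andP; split; apply/andP; split; lra.
have al : a <= l by rewrite le_max lexx.
have rb : r <= b by rewrite ge_min lexx.
have lh y : l <= y <= r -> h x / 2 <= h y.
  rewrite /l /r ge_max le_min => /andP[/andP[_ y1] /andP[_ y2]].
  apply: hdx; rewrite ltr_norml; apply/andP; split; lra.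
have I0 : \int[mu]_(y in `[a, b]) h y = 0.
  by rewrite RintegralB ?eI ?subrr //; exact: continuous_integrable.
have Iab c d' : a <= c -> d' <= b -> 0 <= \int[mu]_(y in `[c, d']) h y.
  move=> ac db; apply: Rintegral_ge0 => y /=; rewrite in_itv /= => /andP[y1 y2].
  by rewrite subr_ge0 fg // (le_trans ac) //= (le_trans y2).
have Il : h x / 2 * (r - l) <= \int[mu]_(y in `[l, r]) h y.
  have <- : \int[mu]_(y in `[l, r]) (h x / 2) = h x / 2 * (r - l).
    rewrite Rintegral_cst; last exact: measurable_itv.
    rewrite -[r - l]/(fine (r - l)%:E); congr (_ * fine _).
    by apply: etrans (lebesgue_measure_itv _) _; rewrite /= lte_fin lr.
  by apply: le_integral_continuous => // z; exact: cvg_cst.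
have : 0 < h x / 2 * (r - l) by rewrite mulr_gt0 ?subr_gt0 ?divr_gt0.
have lb : l <= b := le_trans (ltW lr) rb.
rewrite (integral_split al lb ch) (integral_split (ltW lr) rb ch) in I0.
have I1 := Iab a l (lexx a) (le_trans (ltW lr) rb).
have I2 := Iab r b (le_trans al (ltW lr)) (lexx b).
apply/negP; rewrite -leNgt (le_trans Il) // -I0 addrCA lerDl.
exact: addr_ge0.
Qed.

Lemma continuous_shift f c : continuous f -> continuous (fun x => f (x + c)).
Proof.
move=> cf x; apply: (@continuous_comp _ _ _ (fun x => x + c) f); last exact: cf.
by apply: cvgD; [exact: cvg_id|exact: cvg_cst].
Qed.

Lemma integral_period f T c : 0 <= c <= T -> continuous f ->
  (forall x, f (x + T) = f x) ->
  \int[mu]_(x in `[0, T]) f (x + c) = \int[mu]_(x in `[0, T]) f x.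
Proof.
move=> /andP[c0 cT] cf pf; have T0 := le_trans c0 cT.
rewrite -integral_shift // (@integral_split _ (0 + c) T) //; [|lra|lra].
rewrite [in RHS](@integral_split _ 0 c T) // addrC; congr (_ + _); last by rewrite add0r.
rewrite -{1}(add0r T) (addrC T c) integral_shift //.
by apply: eq_Rintegral => x _.
Qed.

Lemma integral_period2 f T : 0 <= T -> continuous f ->
  (forall x, f (x + T) = f x) ->
  \int[mu]_(x in `[0, 2 * T]) f x = 2 * \int[mu]_(x in `[0, T]) f x.
Proof.
move=> T0 cf pf; rewrite (@integral_split _ 0 T) //; [|lra].
rewrite -{2}(add0r T) (_ : 2 * T = T + T); last lra.
rewrite integral_shift // mulr2n mulrDl !mul1r; congr (_ + _).
by apply: eq_Rintegral => x _.
Qed.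

Lemma integral_abs_cos (u : R -> R) : continuous u ->
  \int[mu]_(x in `[0, pi]) u `|cos x| = 2 * \int[mu]_(x in `[0, pi / 2]) u (cos x).
Proof.
move=> cu.
have cuc : continuous (fun x => u `|cos x|).
  move=> x; apply: (@continuous_comp _ _ _ (fun x => `|cos x|) u); last exact: cu.
  apply: (@continuous_comp _ _ _ (@cos R) Num.norm); first exact: continuous_cos.
  exact: norm_continuous.
have h := @pihalf_gt0 R.
have pc x : u `|cos (x + pi)| = u `|cos x| by rewrite cosDpi normrN.
have cpos (x : R) : x \in `[0, pi / 2]%classic -> u `|cos x| = u (cos x).
  by rewrite inE /= in_itv /= => x0; rewrite ger0_norm // cos_ge0_pihalfW.
rewrite (@integral_split _ 0 (pi / 2)) //; [|lra|lra].
rewrite [RHS]mulr_natl [RHS]mulr2n; congr (_ + _); first exact: eq_Rintegral.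
have := @integral_shift _ (- (pi / 2)) 0 pi _ cuc.
rewrite add0r (_ : - (pi / 2) + pi = pi / 2 :> R); last lra.
move=> -> //; last by lra.
transitivity (\int[mu]_(x in `[- (pi / 2), - 0]) u `|cos x|).
  by rewrite oppr0; apply: eq_Rintegral => x _.
rewrite integral_reflect //; [|exact: ltW].
by apply: eq_Rintegral => x xI; rewrite cosN cpos.
Qed.

End ContinuousIntegrals.

(** * Integration by layers *)

Section Layers.
Context {R : realType}.
Implicit Types (f g rho w : R -> R) (a b c r s T : R).
Notation mu := (@lebesgue_measure R).

Definition level_set T f c : set R := [set x | 0 <= x <= T /\ c <= f x].

Definition level_length T f c : R := fine (mu (level_set T f c)).

Lemma measurable_level T f c : continuous f ->
  measurable (level_set T f c).
Proof.
move=> cf.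
rewrite [X in measurable X](_ : _ = `[0%R, T] `&` f @^-1` `[c, +oo[); last first.
  by apply/seteqP; split => x /=; rewrite !in_itv /= andbT.
apply: measurableI; first exact: measurable_itv.
rewrite -[X in measurable X]setTI.
by apply: (continuous_measurable_fun cf) => //; exact: measurable_itv.
Qed.

Lemma level_le_itv T f c : 0 <= T -> continuous f ->
  (mu (level_set T f c) <= T%:E)%E.
Proof.
move=> T0 cf; rewrite -[in leRHS](subr0 T).
have -> : (T - 0)%:E = mu `[0%R, T].
  rewrite (lebesgue_measure_itv `[0%R, T]) /= lte_fin; case: ltP => // T0'.
  by rewrite (_ : T = 0) ?subrr //; apply/eqP; rewrite eq_le T0 T0'.
apply: le_measure; rewrite ?inE.
- exact: measurable_level.
- exact: measurable_itv.
- by move=> x /= []; rewrite in_itv.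
Qed.

Lemma EFin_level_length T f c : 0 <= T -> continuous f ->
  (level_length T f c)%:E = mu (level_set T f c).
Proof.
move=> T0 cf; rewrite /level_length fineK // ge0_fin_numE //.
exact: le_lt_trans (level_le_itv _ T0 cf) (ltry _).
Qed.

Lemma level_length_ge0 T f c : 0 <= level_length T f c.
Proof. by rewrite /level_length fine_ge0. Qed.

Lemma level_length_le T f c : 0 <= T -> continuous f -> level_length T f c <= T.
Proof.
by move=> T0 cf; rewrite -lee_fin EFin_level_length //; exact: level_le_itv.
Qed.

Lemma integral_upto w b s : continuous w -> 0 <= s <= b ->
  (\int[mu]_(r in `[0%R, b]) (w r * (r <= s)%R%:R)%:E)%E =
  (\int[mu]_(r in `[0%R, s]) w r)%:E.
Proof.
move=> cw /andP[s0 sb]; rewrite -EFin_integral // integral_mkcond [RHS]integral_mkcond.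
apply: eq_integral => r _; rewrite !patchE !mem_setE !in_itv /=.
case: (leP 0 r) => //= r0; case: (leP r s) => [rs|sr] /=.
  by rewrite (le_trans rs sb) mulr1.
by case: ifP => //; rewrite mulr0.
Qed.

(** Both sides are the integral of [w] over the region below the graph of [rho],
    computed by vertical and by horizontal slices. *)
Lemma layer_cake rho w T b : 0 <= T -> continuous rho -> continuous w ->
  (forall x, 0 <= x <= T -> 0 <= rho x <= b) -> (forall r, 0 <= r <= b -> 0 <= w r) ->
  (\int[mu]_(x in `[0%R, T]) (\int[mu]_(r in `[0%R, rho x]) w r)%:E)%E =
  (\int[mu]_(r in `[0%R, b]) (w r * level_length T rho r)%:E)%E.
Proof.
move=> T0 crho cw rhob w0.
pose S := [set p : R * R | (0 <= p.1 <= T /\ 0 <= p.2 <= b) /\ p.2 <= rho p.1].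
pose GR := measurableTypeR R.
pose F (p : GR * GR) := (w p.2 * \1_S p)%:E.
have mS : measurable (S : set (GR * GR)).
  rewrite [X in measurable X](_ : _ = (`[0%R, T] `*` `[0%R, b]) `&`
      (fun p : GR * GR => p.2 <= rho p.1) @^-1` [set true]); last first.
    by apply/seteqP; split => p /=; rewrite !in_itv.
  apply: measurableI; first by apply: measurableX; exact: measurable_itv.
  have : measurable_fun setT (fun p : GR * GR => p.2 <= rho p.1).
    apply: measurable_fun_ler; first exact: measurable_snd.
    apply: measurableT_comp; last exact: measurable_fst.
    exact: continuous_measurable_fun.
  by move=> /(_ measurableT [set true]); rewrite setTI; exact.
have mF : measurable_fun setT F.
  apply/measurable_EFinP; apply: measurable_funM; last exact: measurable_indic.
  apply: measurableT_comp; last exact: measurable_snd.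
  exact: continuous_measurable_fun.
have F0 p : (0 <= F p)%E.
  rewrite lee_fin indicE; have [|_] := boolP (p \in S); last by rewrite mulr0.
  by rewrite inE /= => -[[_ pb] _]; rewrite mulr1 w0.
transitivity (\int[mu]_x \int[mu]_r F (x, r))%E.
  rewrite integral_mkcond; apply: eq_integral => x _.
  rewrite patchE; case: ifPn => [|xT].
    rewrite inE /= in_itv /= => xT.
    rewrite -(integral_upto cw (rhob x xT)) integral_mkcond.
    apply: eq_integral => r _; rewrite patchE /F /= indicE.
    case: ifPn => [|rb].
      rewrite inE /= in_itv /= => rb; congr (_ * (nat_of_bool _)%:R)%:E.
      by apply/idP/idP => [h|]; [rewrite inE|rewrite inE => -[]].
    rewrite memNset ?mulr0 // => -[[_ /= rb'] _].
    by move: rb; rewrite notin_setE /= in_itv.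
  rewrite integral0_eq // => r _; rewrite /F indicE memNset ?mulr0 // => -[[/= xT' _] _].
  by move: xT; rewrite notin_setE /= in_itv.
rewrite (fubini_tonelli F mF F0).
rewrite [RHS]integral_mkcond; apply: eq_integral => r _.
rewrite patchE; case: ifPn => [|rb].
  rewrite inE /= in_itv /= => rb.
  pose L := level_set T rho r.
  have mL : measurable L by exact: measurable_level.
  have muL : mu L = (\int[mu]_x (\1_L x)%:E)%E by rewrite integral_indic ?setIT.
  rewrite EFinM EFin_level_length // -/L muL -ge0_integralZl_EFin //; last first.
  - exact: w0.
  - by apply/measurable_EFinP; exact: measurable_indic.
  apply: eq_integral => x _; rewrite /F /= !indicE -EFinM; congr (_ * (nat_of_bool _)%:R)%:E.
  apply/idP/idP; rewrite !inE /S /L /=; first by move=> [[]].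
  by move=> [xT rx]; split.
rewrite integral0_eq // => x _; rewrite /F indicE memNset ?mulr0 // => -[[/= _ rb'] _].
by move: rb; rewrite notin_setE /= in_itv.
Qed.

Lemma level_length_nonincreasing T f c1 c2 : 0 <= T -> continuous f ->
  c1 <= c2 -> level_length T f c2 <= level_length T f c1.
Proof.
move=> T0 cf c12; rewrite -lee_fin !EFin_level_length //.
apply: le_measure; rewrite ?inE; [exact: measurable_level|exact: measurable_level|].
by move=> x [xT c2x]; split => //; exact: le_trans c2x.
Qed.

Lemma level_length_full T f c : 0 <= T ->
  (forall x, 0 <= x <= T -> c <= f x) -> level_length T f c = T.
Proof.
move=> T0 cf; rewrite /level_length.
have -> : level_set T f c = `[0, T]%classic.
  apply/seteqP; split => x /=; rewrite in_itv /=; first by case.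
  by move=> xT; split => //; exact: cf.
rewrite lebesgue_measure_itv /= lte_fin; case: ltP => /= T0'; first by rewrite subr0.
by apply/eqP; rewrite eq_le T0 T0'.
Qed.

Lemma layer_integrable rho w T b : 0 <= T -> continuous rho -> continuous w ->
  mu.-integrable `[0%R, b] (EFin \o (fun r => w r * level_length T rho r)).
Proof.
move=> T0 crho cw.
have mL : measurable_fun setT (level_length T rho).
  by apply: nonincreasing_measurable => // x y xy; exact: level_length_nonincreasing.
have cTw : continuous (fun r => T * w r).
  by move=> r; apply: cvgM; [exact: cvg_cst|exact: cw].
apply: le_integrable (continuous_integrable 0 b cTw) => //.
  apply/measurable_EFinP; apply: measurable_funM.
    by apply: measurable_funTS; exact: continuous_measurable_fun.
  exact: measurable_funTS.
move=> r _; rewrite /= lee_fin !normrM mulrC ler_wpM2r // !ger0_norm //.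
- exact: level_length_le.
- exact: level_length_ge0.
Qed.

End Layers.

(** * Lengths of superlevel sets *)

Section Distribution.
Context {R : realType}.
Implicit Types (f : R -> R) (c l r M T x : R).
Notation mu := (@lebesgue_measure R).

Lemma strip_radius_leE M c r : 0 < r <= pi / 2 ->
  (strip_radius M c <= r) = (cos r <= M * cos c * sin r).
Proof.
move=> r01; have /andP[r0 r1] := r01.
have s0 : 0 < sin r by apply: sin_gt0_pihalfW.
rewrite -ler_pdivrMr // /strip_radius lerBlDr addrC -lerBlDr.
have -> : cos r / sin r = tan (pi / 2 - r) by rewrite /tan sin_pihalfB cos_pihalfB.
have h := @pihalf_gt0 R.
rewrite -[in RHS](atanK (M * cos c)) !leNgt ltr_tan // in_itv /=.
- by rewrite atan_gtNpi2 atan_ltpi2.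
- by apply/andP; split; lra.
Qed.

Lemma level_set_strip M T f c r : 0 < M -> 0 < r <= pi / 2 ->
  0 <= c <= pi / 2 -> M * cos c * sin r = cos r ->
  (forall x, 0 <= x <= T -> 0 <= f x <= pi / 2) ->
  level_set T (fun x => strip_radius M (f x)) r = level_set T f c.
Proof.
move=> M0 r01 c01 e f01.
have E x : 0 <= x <= T -> (r <= strip_radius M (f x)) = (c <= f x).
  move=> xT; rewrite strip_radius_geE; last by case/andP: r01 => /ltW -> ->.
  rewrite -e ler_pM2r; last exact: sin_gt0_pihalfW.
  by rewrite ler_pM2l // ler_cos_pihalf // f01.
by apply/seteqP; split => x [xT]; [rewrite E|rewrite -E].
Qed.

(** Beyond the inradius [strip_radius M 0] every distance is attained. *)
Lemma strip_angle M r : 0 < M -> strip_radius M 0 <= r <= pi / 2 ->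
  exists2 c, 0 <= c <= pi / 2 & M * cos c * sin r = cos r.
Proof.
move=> M0 /andP[wr r1].
have r0 : 0 < r by rewrite (lt_le_trans (strip_radius_gt0 M 0)).
have s0 : 0 < sin r by apply: sin_gt0_pihalfW; rewrite r0.
have Ms0 : 0 < M * sin r by rewrite mulr_gt0.
have q1 : cos r / (M * sin r) <= 1.
  rewrite ler_pdivrMr // mul1r; move: wr.
  by rewrite strip_radius_leE ?r0 // cos0 mulr1.
have q0 : 0 <= cos r / (M * sin r).
  by rewrite divr_ge0 ?(ltW Ms0) // cos_ge0_pihalfW // (ltW r0).
have qI : -1 <= cos r / (M * sin r) <= 1 by rewrite q1 andbT (le_trans _ q0).
exists (acos (cos r / (M * sin r))).
  rewrite acos_ge0 //= leNgt; apply/negP => h.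
  have p0 := @pihalf_gt0 R; have ps := @pi_split R.
  have : cos (acos (cos r / (M * sin r))) < cos (pi / 2).
    rewrite ltr_cos // in_itv /=; last by rewrite acos_ge0 // acos_lepi.
    by apply/andP; split; lra.
  by rewrite acosK ?in_itv //= cos_pihalf ltNge q0.
rewrite acosK ?in_itv //= mulrAC mulrC divfK //; exact: lt0r_neq0.
Qed.

Lemma level_length_strip M l r : 0 < M -> 0 < r <= pi / 2 ->
  0 <= l <= pi / 2 -> M * cos l * sin r = cos r ->
  level_length (pi / 2) (strip_radius M) r = pi / 2 - l.
Proof.
move=> M0 r01 /andP[l0 l1] e; rewrite /level_length.
have -> : level_set (pi / 2) (strip_radius M) r = `[l, pi / 2]%classic.
  have l01 : 0 <= l <= pi / 2 by rewrite l0.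
  have := @level_set_strip M (pi / 2) id l r M0 r01 l01 e (fun x h => h).
  rewrite /= => ->; apply/seteqP; split => x /=; rewrite in_itv /=.
    by move=> [/andP[x0 x1] lx]; rewrite lx.
  by move=> /andP[lx xp]; split => //; rewrite xp (le_trans l0 lx).
rewrite lebesgue_measure_itv /= lte_fin; case: ltP => //= h.
by apply/eqP; rewrite eq_sym subr_eq0 eq_le h l1.
Qed.

(** Lowering the level of a function that vanishes at both ends of the interval
    enlarges the superlevel set at both ends: to the left of the first point at
    level [c2] and to the right of the last one, the Lipschitz bound keeps the
    function above [c1] for a length of [c2 - c1]. *)
Lemma level_length_drop T f c1 c2 : 
  (forall x y, `|f x - f y| <= `|x - y|) -> f 0 = 0 -> f T = 0 ->
  0 <= T -> 0 <= c1 <= c2 -> (exists2 x, 0 <= x <= T & c2 <= f x) ->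
  level_length T f c2 + 2 * (c2 - c1) <= level_length T f c1.
Proof.
move=> lf f0 fT T0 /andP[c10]; rewrite le_eqVlt => /predU1P[->|c12].
  by rewrite subrr mulr0 addr0.
move=> [x0 x0T fx0].
have cf := lipschitz1_continuous lf.
set S := level_set T f c2.
have S0 : S !=set0 by exists x0.
have lS : has_lbound S by exists 0 => x [/andP[]].
have uS : has_ubound S by exists T => x [/andP[]].
have hS : has_inf S by [].
have hS' : has_sup S by [].
pose q1 := inf S; pose q2 := sup S.
have le_lf x y e : `|x - y| <= e -> f x - e <= f y.
  by move=> xy; have := le_trans (lf x y) xy; rewrite ler_norml => /andP[_]; lra.
have q1f : c2 <= f q1.
  apply/ler_addgt0Pr => e e0.
  have [x Sx xq] := inf_adherent e0 hS.
  have q1x : q1 <= x by exact: ge_inf.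
  have xq1e : `|x - q1| <= e by rewrite ger0_norm ?subr_ge0 // lerBlDl ltW.
  have := le_lf _ _ _ xq1e; case: Sx => _; lra.
have q2f : c2 <= f q2.
  apply/ler_addgt0Pr => e e0.
  have [x Sx xq] := sup_adherent e0 hS'.
  have q2x : x <= q2 by exact: ub_le_sup.
  have xq2e : `|x - q2| <= e.
    by rewrite ler0_norm ?subr_le0 // opprB lerBlDl -lerBlDr ltW.
  have := le_lf _ _ _ xq2e; case: Sx => _; lra.
have q1ge : 0 <= q1 by apply: lb_le_inf => // x [/andP[]].
have q2le : q2 <= T by apply: ge_sup => // x [/andP[]].
have q12 : q1 <= q2.
  by apply: le_trans (ge_inf lS _) (ub_le_sup uS _); [exact: (conj x0T fx0)|].
have d1 : c2 <= q1.
  have := le_lf q1 0 q1; rewrite subr0 ger0_norm // f0 => /(_ (lexx _)); lra.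
have d2 : q2 + c2 <= T.
  have := le_lf q2 T (T - q2); rewrite ler0_norm ?subr_le0 // opprB fT => /(_ (lexx _)).
  lra.
set d := c2 - c1.
have d0 : 0 < d by rewrite subr_gt0.
pose I1 : set R := `[q1 - d, q1[%classic; pose I2 : set R := `]q2, q2 + d]%classic.
have mS : measurable S by exact: measurable_level.
have mI1 : measurable I1 by exact: measurable_itv.
have mI2 : measurable I2 by exact: measurable_itv.
have sub : I1 `|` (S `|` I2) `<=` level_set T f c1.
  move=> x [|[|]].
  - rewrite /I1 /= in_itv /= => /andP[x1 x2]; split; first by rewrite /d in x1; lra.
    have := le_lf q1 x (q1 - x); rewrite ger0_norm ?subr_ge0 ?(ltW x2) // => /(_ (lexx _)).
    by rewrite /d in x1; lra.
  - by move=> [xT c2x]; split => //; lra.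
  - rewrite /I2 /= in_itv /= => /andP[x1 x2]; split; first by rewrite /d in x2; lra.
    have := le_lf q2 x (x - q2); rewrite ler0_norm ?subr_le0 ?(ltW x1) // opprB.
    by move=> /(_ (lexx _)); rewrite /d in x2; lra.
have m1 : mu I1 = d%:E.
  rewrite (lebesgue_measure_itv `[q1 - d, q1[) /= lte_fin ltrBlDr ltrDl d0.
  by rewrite -EFinD opprB addrC subrK.
have m2 : mu I2 = d%:E.
  rewrite (lebesgue_measure_itv `]q2, q2 + d]) /= lte_fin ltrDl d0.
  by rewrite -EFinD addrC addKr.
rewrite -lee_fin EFinD !EFin_level_length //.
apply: (@le_trans _ _ (mu (I1 `|` (S `|` I2)))); last first.
  apply: le_measure => //; rewrite inE; first by do 2 apply: measurableU => //.
  exact: measurable_level.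
have -> : mu (I1 `|` (S `|` I2)) = (mu I1 + (mu S + mu I2))%E.
  rewrite measureU //; last 2 first.
  - exact: measurableU.
  - rewrite -subset0 => x []; rewrite /I1 /= in_itv /= => /andP[_ xq1] [Sx|].
      have : q1 <= x by exact: ge_inf.
      by rewrite leNgt xq1.
    rewrite /I2 /= in_itv /= => /andP[q2x _].
    by have := lt_trans xq1 (le_lt_trans q12 q2x); rewrite ltxx.
  rewrite measureU //; last first.
    rewrite -subset0 => x []; rewrite /I2 /= in_itv /= => Sx /andP[q2x _].
    have : x <= q2 by exact: ub_le_sup.
    by rewrite leNgt q2x.
rewrite m1 m2 (addeC (mu S) d%:E) addeA -EFinD (addeC (mu S)).
by rewrite -/d (_ : 2 * d = d + d) //; lra.
Qed.

(** Since [cos (x + d) / cos x] decreases in [x], reducing a cosine by a given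
    factor takes a smaller increment from the larger of two angles. *)
Lemma angle_gap c1 c2 l1 l2 : 0 <= c1 -> c1 <= c2 -> c2 <= pi / 2 ->
  c1 <= l1 -> l1 <= pi / 2 -> 0 <= l2 <= pi / 2 -> 0 < cos c1 ->
  cos c1 * cos l2 = cos l1 * cos c2 -> l2 - l1 <= c2 - c1.
Proof.
move=> c10 c12 c2h cl1 l1h l2h cc e; have /andP[l20 l21] := l2h.
pose d := c2 - c1; have d0 : 0 <= d by rewrite subr_ge0.
rewrite lerBlDl -/d; have [h|h] := leP (pi / 2) (l1 + d); first exact: le_trans h.
rewrite -ler_cos_pihalf ?l2h //; last by apply/andP; split; lra.
rewrite -(ler_pM2l cc) e (_ : c2 = c1 + d); last by rewrite /d; lra.
have key : 0 <= sin d * sin (l1 - c1).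
  by apply: mulr_ge0; apply: sin_ge0_pihalf; apply/andP; split; rewrite /d; lra.
rewrite -subr_ge0 (_ : _ - _ = sin d * sin (l1 - c1)) // !cosD sinB; ring.
Qed.

End Distribution.

(** * Comparison of a body with a strip *)

Section StripComparison.
Context {R : realType}.
Notation mu := (@lebesgue_measure R).
Variables (M M' : R) (f : R -> R).
Hypotheses (M_gt0 : 0 < M) (leMM' : M <= M').
Hypothesis f_lip : forall x y, `|f x - f y| <= `|x - y|.
Hypothesis f_itv : forall x, 0 <= f x <= pi / 2.
Hypotheses (f_0 : f 0 = 0) (f_pi : f pi = 0).

Let M'_gt0 : 0 < M'. Proof. exact: lt_le_trans leMM'. Qed.
Let f_cont : continuous f. Proof. exact: lipschitz1_continuous. Qed.

(** Here [f] plays the role of the angle to the normal of the strip of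
    parameter [M]: for the strip itself, [f] is the distance to the nearest
    end of the interval from 0 to [pi]. *)
Definition body_radius x := strip_radius M (f x).

Definition body_level r := level_length pi body_radius r.

(** The strip is described on a quarter of the circle only, hence the factor 2
    which brings its level lengths to the half circle of the body. *)
Definition strip_level r := 2 * level_length (pi / 2) (strip_radius M') r.

Let body_cont : continuous body_radius.
Proof. exact: continuous_strip_radius. Qed.

Let strip_cont : continuous (strip_radius M').
Proof. by apply: (@continuous_strip_radius _ M' id) => x; exact: cvg_id. Qed.

Let pih0 : 0 < pi / 2 :> R. Proof. exact: pihalf_gt0. Qed.
Let pi2 : pi = pi / 2 + pi / 2 :> R. Proof. exact: pi_split. Qed.
Let pi0 : 0 <= pi :> R. Proof. exact: pi_ge0. Qed.

Lemma body_radius_itv x : 0 <= body_radius x <= pi / 2.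
Proof.
rewrite ltW ?strip_radius_gt0 //= strip_radius_le // ?(ltW M_gt0) //.
exact: cos_ge0_pihalfW.
Qed.

Lemma strip_radius_itv x : 0 <= x <= pi / 2 -> 0 <= strip_radius M' x <= pi / 2.
Proof.
move=> x01; rewrite ltW ?strip_radius_gt0 //= strip_radius_le // ?(ltW M'_gt0) //.
exact: cos_ge0_pihalfW.
Qed.

Lemma body_level_inner r : r <= strip_radius M 0 -> body_level r = pi.
Proof.
move=> rw; apply: level_length_full => // x _; apply: le_trans rw _.
rewrite /body_radius lerD2l lerN2; apply: le_atan.
by rewrite ler_pM2l // cos0 cos_le1.
Qed.

Lemma strip_level_le r : strip_level r <= pi.
Proof.
rewrite [leRHS]pi2 /strip_level mulr_natl mulr2n.
by apply: lerD; apply: level_length_le => //; exact: ltW.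
Qed.

Lemma strip_level_nonincreasing r1 r2 : r1 <= r2 -> strip_level r2 <= strip_level r1.
Proof.
by move=> r12; rewrite ler_pM2l // level_length_nonincreasing // ltW.
Qed.

Lemma strip_level_lt r : strip_radius M' 0 < r <= pi / 2 -> strip_level r < pi.
Proof.
move=> /andP[wr r1].
have r0 : 0 < r := lt_trans (strip_radius_gt0 _ _) wr.
have r01 : 0 < r <= pi / 2 by rewrite r0.
have wr' : strip_radius M' 0 <= r <= pi / 2 by rewrite ltW.
have [l l01 e] := strip_angle M'_gt0 wr'.
rewrite /strip_level (@level_length_strip _ M' l) //.
have l0 : 0 < l.
  rewrite lt_def; case/andP: l01 => -> _; rewrite andbT.
  apply: contraTneq wr => l0; rewrite -leNgt strip_radius_geE ?(ltW r0) //.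
  by rewrite -[X in cos X]l0 e.
by rewrite [ltRHS]pi2; lra.
Qed.

(** Past the inradius both level functions are governed by the angles [c] and
    [l] at which the body and the strip reach the radius: the one of the body
    drops at least at rate 2 in [c], the one of the strip exactly at rate 2 in
    [l], and [l] varies less than [c] because [M <= M']. *)
Lemma single_crossing r1 r2 : strip_radius M 0 <= r1 -> r1 < pi / 2 ->
  r1 <= r2 -> r2 <= pi / 2 ->
  body_level r1 <= strip_level r1 -> body_level r2 <= strip_level r2.
Proof.
move=> wr1 r1h r12 r2h.
have r1p : 0 < r1 := lt_le_trans (strip_radius_gt0 _ _) wr1.
have r2p : 0 < r2 := lt_le_trans r1p r12.
have wr2 : strip_radius M 0 <= r2 := le_trans wr1 r12.
have ww : strip_radius M' 0 <= strip_radius M 0.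
  by rewrite lerD2l lerN2; apply: le_atan; rewrite ler_pM2r ?cos0.
have h1 : 0 < r1 <= pi / 2 by rewrite r1p ltW.
have h2 : 0 < r2 <= pi / 2 by rewrite r2p.
have s1 : 0 < sin r1 by exact: sin_gt0_pihalfW.
have s2 : 0 < sin r2 by exact: sin_gt0_pihalfW.
have w1 : strip_radius M 0 <= r1 <= pi / 2 by rewrite wr1 ltW.
have w2 : strip_radius M 0 <= r2 <= pi / 2 by rewrite wr2.
have w1' : strip_radius M' 0 <= r1 <= pi / 2 by rewrite (le_trans ww wr1) ltW.
have w2' : strip_radius M' 0 <= r2 <= pi / 2 by rewrite (le_trans ww wr2).
have [c1 c1h e1] := strip_angle M_gt0 w1; have [c2 c2h e2] := strip_angle M_gt0 w2.
have [l1 l1h d1] := strip_angle M'_gt0 w1'; have [l2 l2h d2] := strip_angle M'_gt0 w2'.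
have bl c r : 0 < r <= pi / 2 -> 0 <= c <= pi / 2 -> M * cos c * sin r = cos r ->
    body_level r = level_length pi f c.
  move=> rh ch e; rewrite /body_level /level_length.
  by rewrite (@level_set_strip _ M pi f c r).
rewrite (bl c1 r1) // (bl c2 r2) // /strip_level (@level_length_strip _ M' l1) //.
rewrite (@level_length_strip _ M' l2) //.
have cosr1 : 0 < cos r1 by apply: cos_gt0_pihalf; rewrite r1h andbT; lra.
have cosc1 : 0 < cos c1.
  by move: cosr1; rewrite -e1 pmulr_lgt0 // pmulr_rgt0.
have cosl1 : 0 < cos l1.
  by move: cosr1; rewrite -d1 pmulr_lgt0 // pmulr_rgt0.
have E1 : M * cos c1 = M' * cos l1.
  by apply: (mulIf (lt0r_neq0 s1)); rewrite e1 d1.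
have E2 : M * cos c2 = M' * cos l2.
  by apply: (mulIf (lt0r_neq0 s2)); rewrite e2 d2.
have cl1 : c1 <= l1.
  rewrite -ler_cos_pihalf // -(ler_pM2l M_gt0) E1 ler_wpM2r // ltW //.
have c12 : c1 <= c2.
  rewrite -ler_cos_pihalf // -(ler_pM2r s2) -(ler_pM2l M_gt0) !mulrA e2.
  have := strip_radius_geE M c1 (r := r2).
  have := strip_radius_leE M c1 (r := r2); rewrite h2 => /(_ isT) <- _.
  apply: le_trans r12; rewrite strip_radius_leE // e1 //.
have gap : l2 - l1 <= c2 - c1.
  case/andP: c1h => c10 c1h; case/andP: c2h => c20 c2h; case/andP: l1h => l10 l1h.
  apply: angle_gap => //.
  apply: (mulfI (lt0r_neq0 M_gt0)); apply: (mulfI (lt0r_neq0 M'_gt0)).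
  transitivity ((M * cos c1) * (M' * cos l2)); first by ring.
  by rewrite E1 -E2; ring.
move=> H.
have [[x xT cx]|no] := pselect (exists2 x, 0 <= x <= pi & c2 <= f x).
  have := @level_length_drop _ pi f c1 c2 f_lip f_0 f_pi pi0.
  case/andP: c1h => -> _; rewrite c12 => /(_ isT) /(_ (ex_intro2 _ _ x xT cx)).
  by move=> h; lra.
rewrite /level_length (_ : level_set pi f c2 = set0) ?measure0 /=; last first.
  by rewrite -subset0 => x [xT cx]; apply: no; exists x.
by case/andP: l2h; lra.
Qed.

(** Up to the inradius the body has all directions. Beyond it, the strip stays
    ahead once it has caught up, so the crossing takes place at the infimum of
    the radii where it has. *)
Lemma crossing_radius : exists2 rs, strip_radius M 0 <= rs <= pi / 2 &
  (forall r, 0 <= r < rs -> strip_level r <= body_level r) /\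
  (forall r, rs < r <= pi / 2 -> body_level r <= strip_level r).
Proof.
set w := strip_radius M 0.
have wh : w <= pi / 2 by rewrite strip_radius_le ?cos0 ?(ltW M_gt0).
pose S := [set r | w <= r <= pi / 2 /\ body_level r <= strip_level r] `|` [set pi / 2].
have S0 : S !=set0 by exists (pi / 2); right.
have lS : lbound S w by move=> r [[/andP[]]|->].
have hS : has_inf S by split => //; exists w.
have infle r : S r -> inf S <= r by move=> Sr; apply: ge_inf => //; exists w.
exists (inf S); first by rewrite lb_le_inf //= infle //; right.
have infh : inf S <= pi / 2 by apply: infle; right.
split=> r /andP[r0 r1].
  have [rw|wr] := leP r w; first by rewrite body_level_inner // strip_level_le.
  rewrite leNgt; apply/negP => h.
  suff : inf S <= r by rewrite leNgt r1.
  by apply: infle; left; rewrite /= (ltW wr) (ltW (lt_le_trans r1 infh)) ltW.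
have ri : 0 < r - inf S by rewrite subr_gt0.
have [s Ss] := inf_adherent ri hS; rewrite addrC subrK => sr.
case: Ss sr => [[/andP[ws sh] bs]|->] sr; last by rewrite ltNge r1 in sr.
by apply: (single_crossing ws _ (ltW sr)) => //; exact: lt_le_trans r1.
Qed.


Let two_r (r : R) := 2 * r.

Let two_r_cont : continuous two_r.
Proof. by move=> r; apply: cvgM; [exact: cvg_cst|exact: cvg_id]. Qed.

Let sin_cont : continuous (@sin R). Proof. exact: continuous_sin. Qed.

Lemma integral_two_r s : 0 <= s -> \int[mu]_(r in `[0, s]) two_r r = s ^+ 2.
Proof.
move=> s0; have dF (x : R) : is_derive x (1 : R) (fun r => r ^+ 2) (two_r x).
  by apply: is_derive_eq; rewrite /two_r /GRing.scale /= mulr1 mulr_natl mulr2n.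
by rewrite (integral_FTC s0 two_r_cont dF) expr0n subr0.
Qed.

Lemma integral_sin s : 0 <= s -> \int[mu]_(r in `[0, s]) sin r = 1 - cos s.
Proof.
move=> s0; have dF (x : R) : is_derive x (1 : R) (fun r => - cos r) (sin x).
  by apply: is_derive_eq; rewrite opprK.
by rewrite (integral_FTC s0 sin_cont dF) cos0; lra.
Qed.

Let layer (w : R -> R) : continuous w -> (forall r, 0 <= r <= pi / 2 -> 0 <= w r) ->
  \int[mu]_(x in `[0, pi]) (\int[mu]_(r in `[0, body_radius x]) w r) =
  \int[mu]_(r in `[0, pi / 2]) (w r * body_level r).
Proof.
move=> cw w0; apply: (congr1 fine); apply: layer_cake => // x _.
exact: body_radius_itv.
Qed.

Let layer' (w : R -> R) : continuous w -> (forall r, 0 <= r <= pi / 2 -> 0 <= w r) ->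
  2 * \int[mu]_(x in `[0, pi / 2]) (\int[mu]_(r in `[0, strip_radius M' x]) w r) =
  \int[mu]_(r in `[0, pi / 2]) (w r * strip_level r).
Proof.
move=> cw w0.
have -> : \int[mu]_(r in `[0, pi / 2]) (w r * strip_level r) =
    \int[mu]_(r in `[0, pi / 2])
      (2 * (w r * level_length (pi / 2) (strip_radius M') r)).
  by apply: eq_Rintegral => r _; rewrite /strip_level; ring.
rewrite RintegralZl //; last by apply: layer_integrable => //; exact: ltW.
congr (_ * _); apply: (congr1 fine); apply: layer_cake => //; first exact: ltW.
exact: strip_radius_itv.
Qed.

Let layer_int (w : R -> R) : continuous w ->
  mu.-integrable `[0, pi / 2] (EFin \o (fun r => w r * body_level r)).
Proof. by move=> cw; exact: layer_integrable. Qed.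

Let layer_int' (w : R -> R) : continuous w ->
  mu.-integrable `[0, pi / 2] (EFin \o (fun r => w r * strip_level r)).
Proof.
move=> cw.
rewrite (_ : EFin \o _ = EFin \o
    (fun r => (2 * w r) * level_length (pi / 2) (strip_radius M') r)); last first.
  by apply/funext => r /=; congr EFin; rewrite /strip_level; ring.
apply: layer_integrable => //; first exact: ltW.
by move=> r; apply: cvgM; [exact: cvg_cst|exact: cw].
Qed.

Definition body_square := \int[mu]_(x in `[0, pi]) (body_radius x) ^+ 2.
Definition body_area := \int[mu]_(x in `[0, pi]) (1 - cos (body_radius x)).
Definition strip_square := 2 * \int[mu]_(x in `[0, pi / 2]) (strip_radius M' x) ^+ 2.
Definition strip_area := 2 * \int[mu]_(x in `[0, pi / 2]) (1 - cos (strip_radius M' x)).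

Lemma body_square_layers :
  body_square = \int[mu]_(r in `[0, pi / 2]) (two_r r * body_level r).
Proof.
rewrite -layer //; last by move=> r /andP[r0 _]; rewrite mulr_ge0.
apply: eq_Rintegral => x _; rewrite integral_two_r //.
by case/andP: (body_radius_itv x).
Qed.

Lemma body_area_layers :
  body_area = \int[mu]_(r in `[0, pi / 2]) (sin r * body_level r).
Proof.
rewrite -layer //; last by move=> r; exact: sin_ge0_pihalf.
apply: eq_Rintegral => x _; rewrite integral_sin //.
by case/andP: (body_radius_itv x).
Qed.

Lemma strip_square_layers :
  strip_square = \int[mu]_(r in `[0, pi / 2]) (two_r r * strip_level r).
Proof.
rewrite -layer' //; last by move=> r /andP[r0 _]; rewrite mulr_ge0.
congr (_ * _); apply: eq_Rintegral => x _; rewrite integral_two_r //.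
exact/ltW/strip_radius_gt0.
Qed.

Lemma strip_area_layers :
  strip_area = \int[mu]_(r in `[0, pi / 2]) (sin r * strip_level r).
Proof.
rewrite -layer' //; last by move=> r; exact: sin_ge0_pihalf.
congr (_ * _); apply: eq_Rintegral => x _; rewrite integral_sin //.
exact/ltW/strip_radius_gt0.
Qed.

(** By layers, a pointwise bound in the radius on the difference of the level
    lengths becomes a bound between areas and squares. *)
Lemma level_comparison lam (e : R -> R) :
  mu.-integrable `[0, pi / 2] (EFin \o e) ->
  (forall r, 0 <= r <= pi / 2 ->
    e r <= (lam * sin r - 2 * r) * (body_level r - strip_level r)) ->
  \int[mu]_(r in `[0, pi / 2]) e r <=
  lam * (body_area - strip_area) - (body_square - strip_square).
Proof.
move=> ie He.
have i1 := layer_int sin_cont; have i2 := layer_int' sin_cont.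
have i3 := layer_int two_r_cont; have i4 := layer_int' two_r_cont.
pose D (w : R -> R) r := w r * body_level r - w r * strip_level r.
have iD (w : R -> R) : continuous w -> mu.-integrable `[0, pi / 2] (EFin \o D w).
  move=> cw; apply: (fun m => integrableB m (layer_int cw) (layer_int' cw)).
  exact: measurable_itv.
have iDl : mu.-integrable `[0, pi / 2] (EFin \o (fun r => lam * D (@sin R) r)).
  by apply: (fun m => integrableZl m lam (iD _ sin_cont)); exact: measurable_itv.
have -> : lam * (body_area - strip_area) - (body_square - strip_square) =
    \int[mu]_(r in `[0, pi / 2]) (lam * D (@sin R) r - D two_r r).
  rewrite RintegralB //; last exact: iD.
  rewrite RintegralZl //; last exact: iD.
  rewrite RintegralB // RintegralB //.
  by rewrite body_area_layers strip_area_layers body_square_layers strip_square_layers.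
apply: le_Rintegral => //.
  by apply: (fun m => integrableB m iDl (iD _ two_r_cont)); exact: measurable_itv.
move=> r /=; rewrite in_itv /= => /He; rewrite /D /two_r; lra.
Qed.

(** The multiplier [2 rs / sin rs] is the slope at the crossing radius [rs] of
    the square of the radius as a convex function of the area density
    [1 - cos]; with it the integrand has a constant sign. *)
Lemma strip_majorization : exists lam d, [/\ 0 <= d, (M < M' -> 0 < d) &
  d <= lam * (body_area - strip_area) - (body_square - strip_square)].
Proof.
have [rs /andP[wrs rsh] [below above]] := crossing_radius.
have rs0 : 0 < rs := lt_le_trans (strip_radius_gt0 _ _) wrs.
have srs : 0 < sin rs by apply: sin_gt0_pihalfW; rewrite rs0.
pose lam := 2 * rs / sin rs.
have lamE r : lam * sin r - 2 * r = 2 / sin rs * (rs * sin r - r * sin rs).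
  by rewrite /lam; field; exact: lt0r_neq0.
have k0 : 0 < 2 / sin rs by rewrite divr_gt0.
have pos r : 0 <= r < rs -> 0 <= lam * sin r - 2 * r.
  move=> /andP[r0 rrs]; rewrite lamE mulr_ge0 ?(ltW k0) // subr_ge0.
  exact: sinc_le (ltW rrs) rsh.
have base r : 0 <= r <= pi / 2 ->
    0 <= (lam * sin r - 2 * r) * (body_level r - strip_level r).
  move=> /andP[r0 rh]; case: (ltgtP r rs) => [rrs|rsr|->].
  - by rewrite mulr_ge0 ?pos ?r0 // subr_ge0 below // r0.
  - apply: mulr_le0; last by rewrite subr_le0 above // rsr.
    rewrite lamE mulr_ge0_le0 ?(ltW k0) // subr_le0.
    exact: sinc_le (ltW rs0) (ltW rsr) rh.
  - by rewrite lamE subrr mulr0 mul0r.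
have [MM'|] := ltP M M'; last first.
  move=> M'M; exists lam, 0; split => //.
  apply: le_trans (@level_comparison lam (fun=> 0) _ _) => //.
    by rewrite Rintegral_cst ?mul0r //; exact: measurable_itv.
  by apply: continuous_integrable => x; exact: cvg_cst.
have ww : strip_radius M' 0 < strip_radius M 0.
  by rewrite ltrD2l ltrN2; apply: lt_atan; rewrite cos0 !mulr1.
pose w' := strip_radius M' 0; pose w := strip_radius M 0.
(* between the two inradii the strip has lost directions and the body none *)
pose a := (w' * 2 + w) / 3; pose b := (w' + w * 2) / 3.
have w'a : w' < a by rewrite /a; rewrite -/w -/w' in ww; lra.
have ab : a < b by rewrite /a /b; rewrite -/w -/w' in ww; lra.
have bw : b < w by rewrite /b; rewrite -/w -/w' in ww; lra.
have w'0 : 0 < w' := strip_radius_gt0 _ _.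
have a0 : 0 < a := lt_trans w'0 w'a.
have brs : b < rs := lt_le_trans bw wrs.
have b0 : 0 < b := lt_trans a0 ab.
have bh : b <= pi / 2 := le_trans (ltW brs) rsh.
pose k := 2 / sin rs * (a * (rs * sin b - b * sin rs) / b).
have sb : 0 < rs * sin b - b * sin rs by rewrite subr_gt0 sinc_lt.
have kp : 0 < k by rewrite mulr_gt0 // divr_gt0 // mulr_gt0.
have Lp : 0 < pi - strip_level a.
  rewrite subr_gt0 strip_level_lt // w'a /=; apply: ltW.
  exact: lt_le_trans ab bh.
pose e r := k * (pi - strip_level a) * \1_(`[a, b] : set R) r.
exists lam, (k * (pi - strip_level a) * (b - a)); split.
- by rewrite mulr_ge0 ?subr_ge0 ?(ltW ab) // mulr_ge0 ?(ltW kp) ?(ltW Lp).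
- by move=> _; rewrite mulr_gt0 ?subr_gt0 // mulr_gt0.
have I1 : mu.-integrable `[0, pi / 2] (EFin \o \1_(`[a, b] : set R)).
  apply: (integrableS measurableT) => //; exact: integrable_indic_itv.
have <- : \int[mu]_(r in `[0, pi / 2]) e r = k * (pi - strip_level a) * (b - a).
  rewrite RintegralZl //; congr (_ * _).
  rewrite /Rintegral integral_indic // (_ : _ `&` _ = `[a, b]%classic); last first.
    apply/seteqP; split => r /=; rewrite !in_itv /=; first by case.
    move=> /andP[ra rb]; rewrite ra rb (le_trans (ltW a0) ra) //.
    by rewrite (le_trans rb).
  rewrite -[b - a]/(fine (b - a)%:E); congr fine.
  by apply: etrans (lebesgue_measure_itv _) _; rewrite /= lte_fin ab.
apply: level_comparison.
  by apply: (fun m => integrableZl m (k * (pi - strip_level a)) I1); exact: measurable_itv.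
move=> r rI; rewrite /e indicE; case: (boolP (r \in _)); last first.
  by rewrite mulr0 => _; exact: base.
rewrite inE /= in_itv /= mulr1 => /andP[ar rb].
have rrs : r < rs := le_lt_trans rb brs.
have r0 : 0 < r := lt_le_trans a0 ar.
rewrite body_level_inner ?(le_trans rb) ?(ltW bw) //.
apply: ler_pM; [exact: ltW|exact: ltW| |]; last first.
  by rewrite lerD2l lerN2 strip_level_nonincreasing.
rewrite lamE /k ler_pM2l // ler_pdivrMr //.
have h1 : a * (rs * sin b - b * sin rs) <= r * (rs * sin b - b * sin rs).
  by rewrite ler_pM2r.
have h2 : rs * (r * sin b) <= rs * (b * sin r).
  by rewrite ler_pM2l //; exact: sinc_le (ltW r0) rb bh.
lra.
Qed.

End StripComparison.

(** * The strip of given area *)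

Section StripArea.
Context {R : realType}.
Implicit Types (M x y : R).
Notation mu := (@lebesgue_measure R).

Lemma sin_atan y : sin (atan y) = y / Num.sqrt (1 + y ^+ 2).
Proof.
have c0 : cos (atan y) != 0.
  by apply/lt0r_neq0/cos_gt0_pihalf; rewrite atan_gtNpi2 atan_ltpi2.
by rewrite -cos_atan -{2}(atanK y) /tan divfK.
Qed.

Lemma ltr_sin_atan : {mono (fun y : R => sin (atan y)) : x y / x < y}.
Proof.
apply: leW_mono; apply: le_mono => x y xy; rewrite ltr_sin ?lt_atan //.
- by rewrite in_itv /= !ltW ?atan_gtNpi2 ?atan_ltpi2.
- by rewrite in_itv /= !ltW ?atan_gtNpi2 ?atan_ltpi2.
Qed.

(** The integrand has the primitive [x - asin (k * sin x)], where [k] is the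
    sine of [atan M], and this primitive takes the value
    [pi / 2 - atan M] at [pi / 2]. *)
Lemma strip_area_value M : 0 < M -> strip_area M = 2 * (pi / 2 - atan M).
Proof.
move=> M0; rewrite /strip_area; congr (_ * _).
have q0 : 0 < 1 + M ^+ 2 by rewrite ltr_wpDr // sqr_ge0.
pose k := sin (atan M).
have k2 : k ^+ 2 = M ^+ 2 / (1 + M ^+ 2).
  by rewrite /k sin_atan expr_div_n sqr_sqrtr // ltW.
have k2lt : k ^+ 2 < 1 by rewrite k2 ltr_pdivrMr // mul1r ltrDr.
have ksin x : -1 < k * sin x < 1.
  rewrite -ltr_norml -(ltr_pXn2r (n := 2)) ?nnegrE // expr1n real_normK ?num_real //.
  by rewrite exprMn (le_lt_trans _ k2lt) // ler_piMr ?sqr_ge0 // sin2cos2 gerBl sqr_ge0.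
have dF x : is_derive x (1 : R) (fun x => x - asin (k * sin x))
    (1 - cos (strip_radius M x)).
  have da := is_derive1_asin (ksin x).
  have ds : is_derive x (1 : R) (fun x => k * sin x) (k * cos x).
    by apply: is_derive_eq.
  have dc : is_derive x (1 : R) (fun x => asin (k * sin x))
      ((Num.sqrt (1 - (k * sin x) ^+ 2))^-1 * (k * cos x)).
    exact: (@is_derive1_comp _ (@asin R) (fun x => k * sin x)).
  apply: is_derive_eq; congr (_ - _).
  rewrite cos_strip_radius sin_atan.
  have s0 : 0 < 1 - (k * sin x) ^+ 2.
    rewrite subr_gt0 -real_normK ?num_real // expr_lt1 // ltr_norml; exact: ksin.
  have -> : 1 + (M * cos x) ^+ 2 = (1 + M ^+ 2) * (1 - (k * sin x) ^+ 2).
    rewrite !exprMn k2 sin2cos2; field; exact: lt0r_neq0.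
  rewrite (sqrtrM _ (ltW q0)) {2}/k sin_atan; field.
  by rewrite !lt0r_neq0 // sqrtr_gt0.
have cf : continuous (fun x => 1 - cos (strip_radius M x)).
  apply: continuous_1mcos; apply: (@continuous_strip_radius _ M id) => x.
  exact: cvg_id.
have asin0 : asin 0 = 0 :> R.
  by rewrite -[X in asin X]sin0 sinK // in_itv /= oppr_le0 !ltW ?pihalf_gt0.
rewrite (integral_FTC (ltW (@pihalf_gt0 R)) cf dF) /= sin_pihalf mulr1 sin0 mulr0.
rewrite asin0 !subr0 /k sinK // in_itv /=.
by rewrite !ltW ?atan_gtNpi2 ?atan_ltpi2.
Qed.

(** A lune of angular width [2 * w] is the strip of inradius [w]. *)
Lemma strip_radius_tan w x : 0 < w < pi / 2 -> 0 <= x < pi / 2 ->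
  strip_radius (tan (pi / 2 - w)) x = atan (tan w / cos x).
Proof.
move=> /andP[w0 w1] /andP[x0 x1].
have cx : 0 < cos x.
  by apply: cos_gt0_pihalf; rewrite x1 andbT (lt_le_trans _ x0) // oppr_lt0 pihalf_gt0.
have cw : 0 < cos w.
  by apply: cos_gt0_pihalf; rewrite w1 andbT (lt_trans _ w0) // oppr_lt0 pihalf_gt0.
have sw : 0 < sin w by apply: sin_gt0_pihalf; rewrite w0.
set M := tan (pi / 2 - w).
have ME : M = cos w / sin w by rewrite /M /tan sin_pihalfB cos_pihalfB.
have M0 : 0 < M by rewrite ME divr_gt0.
have y0 : 0 < M * cos x by rewrite mulr_gt0.
have a0 : 0 < atan (M * cos x) by rewrite -(@atan0 R) lt_atan.
have sa : 0 < sin (atan (M * cos x)) by rewrite -(@sin0 R) -{1}(@atan0 R) ltr_sin_atan.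
rewrite /strip_radius -[LHS]tanK; last first.
  rewrite in_itv /=; have := atan_ltpi2 (M * cos x); have := @pihalf_gt0 R.
  by move=> h1 h2; apply/andP; split; lra.
congr atan; rewrite {1}/tan sin_pihalfB cos_pihalfB.
rewrite -[LHS]invrK invfM invrK mulrC -/(tan _) atanK ME /tan.
by field; rewrite !lt0r_neq0.
Qed.

Lemma integral_lune w : 0 < w < pi / 2 ->
  (\int[mu]_(x in `[0%R, (pi / 2)%R]) ((atan (tan w / cos x)) ^+ 2)%:E)%E =
  (\int[mu]_(x in `[0, pi / 2]) (strip_radius (tan (pi / 2 - w)) x) ^+ 2)%:E.
Proof.
move=> w01; set M := tan (pi / 2 - w).
have cs : continuous (fun x => (strip_radius M x) ^+ 2).
  apply: continuous_sqr; apply: (@continuous_strip_radius _ M id) => x.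
  exact: cvg_id.
(* at the endpoint the quotient by [cos x] is a quotient by 0 *)
have E x : x \in `[0, pi / 2[%classic ->
    ((atan (tan w / cos x)) ^+ 2)%:E = ((strip_radius M x) ^+ 2)%:E.
  by rewrite inE /= in_itv /= => x01; rewrite strip_radius_tan.
have mE : measurable_fun `[0, pi / 2[%classic
    (fun x => ((strip_radius M x) ^+ 2)%:E).
  apply/measurable_EFinP/measurable_funTS; exact: continuous_measurable_fun.
rewrite -EFin_integral // -[LHS]integral_itv_bndo_bndc; last first.
  by apply: eq_measurable_fun mE => x xI; exact/esym/E.
by rewrite -[RHS]integral_itv_bndo_bndc //; exact: eq_integral.
Qed.

End StripArea.

(** * The inequality for radial functions *)

Section RadialInequality.
Context {R : realType}.
Notation mu := (@lebesgue_measure R).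
Variables (M : R) (f : R -> R).
Hypothesis M_gt0 : 0 < M.
Hypothesis f_lip : forall x y, `|f x - f y| <= `|x - y|.
Hypothesis f_itv : forall x, 0 <= f x <= pi / 2.
Hypotheses (f_0 : f 0 = 0) (f_pi : f pi = 0).

Let f_cont : continuous f. Proof. exact: lipschitz1_continuous. Qed.
Let pih0 : 0 < pi / 2 :> R. Proof. exact: pihalf_gt0. Qed.
Let pi2 : pi = pi / 2 + pi / 2 :> R. Proof. exact: pi_split. Qed.

Let u (y : R) := 1 - sin (atan (M * y)).

Let u_cont : continuous u.
Proof.
move=> y; apply: cvgB; first exact: cvg_cst.
apply: (@continuous_comp _ _ _ (fun y => atan (M * y)) (@sin R)); last first.
  exact: continuous_sin.
apply: (@continuous_comp _ _ _ (fun y => M * y) (@atan R)); last exact: continuous_atan.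
by apply: cvgM; [exact: cvg_cst|exact: cvg_id].
Qed.

Let u_lt y z : (u z < u y) = (y < z).
Proof. by rewrite ltrD2l ltrN2 ltr_sin_atan ltr_pM2l. Qed.

Let u_le y z : (u z <= u y) = (y <= z).
Proof. by rewrite !leNgt u_lt. Qed.

Let body_areaE : body_area M f = \int[mu]_(x in `[0, pi]) u (cos (f x)).
Proof. by apply: eq_Rintegral => x _; rewrite /body_radius cos_strip_radius. Qed.

Let strip_areaE : strip_area M = \int[mu]_(x in `[0, pi]) u `|cos x|.
Proof.
rewrite integral_abs_cos //; congr (_ * _).
by apply: eq_Rintegral => x _; rewrite cos_strip_radius.
Qed.

Let uf_cont : continuous (fun x => u (cos (f x))).
Proof.
move=> x; apply: (@continuous_comp _ _ _ (fun x => cos (f x)) u); last exact: u_cont.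
by apply: (@continuous_comp _ _ _ f (@cos R)); [exact: f_cont|exact: continuous_cos].
Qed.

Let uc_cont : continuous (fun x => u `|cos x|).
Proof.
move=> x; apply: (@continuous_comp _ _ _ (fun x => `|cos x|) u); last exact: u_cont.
apply: (@continuous_comp _ _ _ (@cos R) Num.norm); first exact: continuous_cos.
exact: norm_continuous.
Qed.

(** The body lies in the strip with the same inradius. *)
Lemma norm_cos_le x : 0 <= x <= pi -> `|cos x| <= cos (f x).
Proof.
move=> /andP[x0 x1]; have /andP[fx0 fxh] := f_itv x.
have fx1 : f x <= x.
  have := f_lip x 0; rewrite f_0 !subr0 (ger0_norm x0) => h.
  exact: le_trans (ler_norm _) h.
have fx2 : f x <= pi - x.
  have := f_lip x pi; rewrite f_pi subr0 (distrC x) (ger0_norm (x := pi - x)) ?subr_ge0 // => h.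
  exact: le_trans (ler_norm _) h.
have [xh|hx] := leP x (pi / 2).
  by rewrite ger0_norm ?ler_cos_pihalf ?cos_ge0_pihalfW ?x0 ?fx0.
have e : cos x = - cos (pi - x).
  by rewrite cosB cospi sinpi; lra.
rewrite e normrN.
have h : 0 <= pi - x <= pi / 2 by apply/andP; split; lra.
by rewrite ger0_norm ?ler_cos_pihalf ?cos_ge0_pihalfW ?fx0.
Qed.

(** Half of the angular width of the lune with the area of the body: a lune of
    angular width [2 * w] has area [4 * w], and [body_area] accounts for half of
    the directions. *)
Definition lune_angle := body_area M f / 2.

Let area_le : body_area M f <= strip_area M.
Proof.
rewrite body_areaE strip_areaE; apply: le_integral_continuous => // x xI.
by rewrite u_le norm_cos_le.
Qed.

Lemma lune_angle_itv : 0 < lune_angle < pi / 2.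
Proof.
apply/andP; split.
  apply: divr_gt0 => //; apply: (@lt_le_trans _ _ (pi * u 1)).
    rewrite mulr_gt0 ?pi_gt0 // subr_gt0 mulr1 sin_atan.
    rewrite ltr_pdivrMr ?mul1r ?sqrtr_gt0 ?ltr_wpDr ?sqr_ge0 //.
    rewrite -[ltLHS]ger0_norm ?(ltW M_gt0) // -sqrtr_sqr ltr_sqrt ?ltrDr //.
    by rewrite ltr_wpDr ?sqr_ge0.
  have -> : pi * u 1 = \int[mu]_(x in `[0, pi]) u 1.
    rewrite Rintegral_cst; last exact: measurable_itv.
    rewrite mulrC; congr (_ * _); rewrite -[pi in LHS]/(fine (pi)%:E); congr fine.
    apply: esym; apply: etrans (lebesgue_measure_itv _) _.
    by rewrite /= lte_fin pi_gt0 oppr0 adde0.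
  rewrite body_areaE; apply: le_integral_continuous => //.
    by move=> x; exact: cvg_cst.
  by move=> x _; rewrite u_le cos_le1.
rewrite ltr_pdivrMr //; apply: le_lt_trans area_le _.
rewrite strip_area_value // mulrC ltr_pM2r // gtrBl.
by rewrite -(@atan0 R) lt_atan.
Qed.

(** The parameter of this lune as a strip, the cotangent of its inradius. *)
Definition lune_slope := tan (pi / 2 - lune_angle).

Let atan_slope : atan lune_slope = pi / 2 - lune_angle.
Proof.
have /andP[h1 h2] := lune_angle_itv.
by rewrite tanK // in_itv /=; apply/andP; split; lra.
Qed.

Let slope_gt0 : 0 < lune_slope.
Proof.
have /andP[h1 h2] := lune_angle_itv.
rewrite ltNge; apply/negP => /le_atan; rewrite atan0 atan_slope; lra.
Qed.

Let same_area : strip_area lune_slope = body_area M f.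
Proof.
by rewrite strip_area_value // atan_slope opprB addrC subrK /lune_angle mulrC divfK.
Qed.

(* the body lies in the strip of parameter [M], whose area is then the larger *)
Let slope_le : M <= lune_slope.
Proof.
rewrite leNgt; apply/negP => /lt_atan h.
have := area_le; rewrite -same_area !strip_area_value //; lra.
Qed.

Lemma radial_inequality : body_square M f <= strip_square lune_slope.
Proof.
have [lam [d [d0 _]]] := strip_majorization M_gt0 slope_le f_lip f_itv f_0 f_pi.
rewrite same_area subrr mulr0; lra.
Qed.

(** If the two parameters differ, the comparison is strict; if they agree, the
    body has the area of the strip that contains it. *)
Lemma radial_equality :
  (body_square M f = strip_square lune_slope) <->
  (forall x, 0 <= x <= pi -> cos (f x) = `|cos x|).
Proof.
split=> [eq_sq x xI|eq_cos].
  have [lam [d [d0 strict]]] := strip_majorization M_gt0 slope_le f_lip f_itv f_0 f_pi.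
  rewrite same_area subrr mulr0 eq_sq subrr subr0 => d_le0.
  have MM : lune_slope = M.
    apply/eqP; rewrite eq_le slope_le andbT leNgt; apply/negP => /strict.
    by rewrite ltNge d_le0.
  apply/eqP; rewrite eq_le norm_cos_le // andbT -u_le.
  rewrite -(@eq_continuous_integral _ (fun x => u (cos (f x))) (fun x => u `|cos x|) 0 pi) //.
  - exact: pi_gt0.
  - by move=> y yI; rewrite u_le norm_cos_le.
  - by rewrite -body_areaE -strip_areaE -same_area MM.
have aM : atan lune_slope = atan M.
  have : body_area M f = strip_area M.
    rewrite body_areaE strip_areaE; apply: eq_Rintegral => x.
    by rewrite inE /= in_itv /= => /eq_cos ->.
  by rewrite -same_area !strip_area_value //; lra.
have -> : lune_slope = M by rewrite -[LHS]atanK aM atanK.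
pose v (y : R) := (pi / 2 - atan (M * y)) ^+ 2.
have cv : continuous v.
  apply: continuous_sqr => y; apply: cvgB; first exact: cvg_cst.
  apply: (@continuous_comp _ _ _ (fun y => M * y) (@atan R)); last exact: continuous_atan.
  by apply: cvgM; [exact: cvg_cst|exact: cvg_id].
rewrite /strip_square -(@integral_abs_cos _ v) //; apply: eq_Rintegral => x.
by rewrite inE /= in_itv /= => /eq_cos e; rewrite /body_radius /strip_radius e.
Qed.

End RadialInequality.

(** * Polar coordinates on the hemisphere *)

Section SphereVectors.
Context {R : realType}.
Implicit Types (x y z n v : 'rV[R]_3) (a b c k t s phi : R).

Lemma dot3 x y : dot x y = x 0 0 * y 0 0 + x 0 1 * y 0 1 + x 0 2 * y 0 2.
Proof.
rewrite /dot !big_ord_recl big_ord0 addr0 !addrA.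
by congr (_ * _ + _ * _ + _ * _); congr (_ _ _); apply/val_inj.
Qed.

Lemma vec3_0 a b c : vec3 a b c 0 0 = a. Proof. by rewrite mxE. Qed.
Lemma vec3_1 a b c : vec3 a b c 0 1 = b. Proof. by rewrite mxE. Qed.
Lemma vec3_2 a b c : vec3 a b c 0 2 = c. Proof. by rewrite mxE. Qed.

Definition vec3K := (vec3_0, vec3_1, vec3_2).

Lemma eq_vec3 x y : x 0 0 = y 0 0 -> x 0 1 = y 0 1 -> x 0 2 = y 0 2 -> x = y.
Proof.
move=> e0 e1 e2; apply/rowP => i.
case: i => [[|[|[|//]]] h].
- by rewrite (_ : Ordinal h = 0) //; apply/val_inj.
- by rewrite (_ : Ordinal h = 1) //; apply/val_inj.
- by rewrite (_ : Ordinal h = 2) //; apply/val_inj.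
Qed.

Lemma dot_pole x : dot x pole = x 0 2.
Proof. by rewrite dot3 !vec3K !mulr0 !add0r mulr1. Qed.

Lemma dotDl x y z : dot (x + y) z = dot x z + dot y z.
Proof. by rewrite !dot3 !mxE; ring. Qed.

Lemma dotZl k x y : dot (k *: x) y = k * dot x y.
Proof. by rewrite !dot3 !mxE; ring. Qed.

Lemma dotC x y : dot x y = dot y x.
Proof. by rewrite !dot3; ring. Qed.

Lemma dot_ge0 x : 0 <= dot x x.
Proof. by rewrite dot3 -!expr2 !addr_ge0 ?sqr_ge0. Qed.

Lemma dot_eq0 x : dot x x = 0 -> x = 0.
Proof.
rewrite dot3 -!expr2 => /eqP; rewrite paddr_eq0 ?addr_ge0 ?sqr_ge0 // => /andP[].
rewrite paddr_eq0 ?sqr_ge0 // !sqrf_eq0 => /andP[/eqP h0 /eqP h1] /eqP h2.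
by apply: eq_vec3; rewrite mxE.
Qed.

Lemma dot_gt0 x : x != 0 -> 0 < dot x x.
Proof.
by move=> x0; rewrite lt_def dot_ge0 andbT; apply: contraNneq x0 => /dot_eq0 ->.
Qed.

Lemma tangent_dir_tangent phi : tangent_circle (tangent_dir phi).
Proof.
split; rewrite /sphere /= dot3 !vec3K ?mul0r ?mulr0 ?addr0 //.
by rewrite -!expr2 cos2Dsin2.
Qed.

Lemma tangent_dirDpi phi : tangent_dir (phi + pi) = - tangent_dir phi.
Proof. by apply: eq_vec3; rewrite !mxE /= ?cosDpi ?sinDpi ?oppr0. Qed.

Lemma quarter_turn_dir phi : quarter_turn (tangent_dir phi) = tangent_dir (phi + pi / 2).
Proof. by rewrite /quarter_turn /tangent_dir !vec3K cosDpihalf sinDpihalf. Qed.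

Lemma geod_dir phi t :
  geod (tangent_dir phi) t = vec3 (sin t * cos phi) (sin t * sin phi) (cos t).
Proof. by apply: eq_vec3; rewrite !mxE /=; ring. Qed.

Lemma geod_dir2 phi t : geod (tangent_dir phi) t 0 2 = cos t.
Proof. by rewrite geod_dir vec3K. Qed.

Lemma geodN v t : geod (- v) (- t) = geod v t.
Proof. by rewrite /geod cosN sinN scalerN scaleNr opprK. Qed.

Lemma geod_sphere phi t : sphere (geod (tangent_dir phi) t).
Proof.
rewrite /sphere /= geod_dir dot3 !vec3K.
have h1 := cos2Dsin2 phi; have h2 := cos2Dsin2 t.
transitivity (sin t ^+ 2 * (cos phi ^+ 2 + sin phi ^+ 2) + cos t ^+ 2); first ring.
by rewrite h1 mulr1 addrC.
Qed.

Lemma geod_hemisphere phi t : - (pi / 2) <= t <= pi / 2 ->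
  hemisphere (geod (tangent_dir phi) t).
Proof.
move=> th; split; first exact: geod_sphere.
by rewrite dot_pole geod_dir2 cos_ge0_pihalf.
Qed.

Lemma geod_perp phi t :
  dot (geod (tangent_dir (phi + pi / 2)) t) (tangent_dir phi) = 0.
Proof.
by rewrite geod_dir dot3 !vec3K cosDpihalf sinDpihalf; ring.
Qed.

Lemma geod0 v : geod v 0 = pole.
Proof. by rewrite /geod cos0 sin0 scale1r scale0r addr0. Qed.

Lemma geod_dir_period phi t : geod (tangent_dir (phi + pi)) (- t) = geod (tangent_dir phi) t.
Proof. by rewrite tangent_dirDpi geodN. Qed.

Lemma circle_angle a b : a ^+ 2 + b ^+ 2 = 1 -> exists phi, a = cos phi /\ b = sin phi.
Proof.
move=> ab1.
have aI : -1 <= a <= 1.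
  rewrite -ler_norml -(ler_pXn2r (n := 2)) ?nnegrE // expr1n real_normK ?num_real //.
  by rewrite -ab1 lerDl sqr_ge0.
have sE : sin (acos a) ^+ 2 = b ^+ 2.
  by rewrite sin2cos2 acosK ?in_itv // -ab1 addrC addKr.
have s0 : 0 <= sin (acos a).
  by apply: sin_ge0_pi; rewrite acos_ge0 // acos_lepi.
have [b0|b0] := leP 0 b.
  exists (acos a); rewrite acosK ?in_itv //; split => //.
  by apply/eqP; rewrite -(eqrXn2 (n := 2)) // sE.
exists (- acos a); rewrite cosN acosK ?in_itv // sinN; split => //.
apply/eqP; rewrite -eqr_oppLR -(eqrXn2 (n := 2)) // ?sE ?sqrrN //.
by rewrite oppr_ge0 ltW.
Qed.

Lemma polar_coordinates x : hemisphere x ->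
  exists phi t, 0 <= t <= pi / 2 /\ x = geod (tangent_dir phi) t.
Proof.
move=> [sx]; rewrite dot_pole => x2.
move: sx; rewrite /sphere /= dot3 -!expr2 => sx.
have x2I : -1 <= x 0 2 <= 1.
  rewrite (le_trans _ x2) ?lerN10 //= -(ler_pXn2r (n := 2)) ?nnegrE // expr1n -sx lerDr.
  by rewrite addr_ge0 ?sqr_ge0.
pose t := acos (x 0 2).
have ct : cos t = x 0 2 by rewrite acosK ?in_itv.
have t0 : 0 <= t by rewrite acos_ge0.
have th : t <= pi / 2.
  rewrite leNgt; apply/negP => h.
  have : cos t < cos (pi / 2).
    rewrite ltr_cos // in_itv /=; last by rewrite t0 acos_lepi.
    have := @pihalf_gt0 R; have := @pi_split R; move=> h1 h2; apply/andP; split; lra.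
  by rewrite cos_pihalf ct ltNge x2.
have st2 : x 0 0 ^+ 2 + x 0 1 ^+ 2 = sin t ^+ 2.
  by rewrite sin2cos2 ct -sx addrK.
have [st|st] := eqVneq (sin t) 0.
  exists 0, t; rewrite t0; split => //; rewrite geod_dir st !mul0r.
  move: st2; rewrite st expr0n /= => /eqP; rewrite paddr_eq0 ?sqr_ge0 // !sqrf_eq0.
  by move=> /andP[/eqP h0 /eqP h1]; apply: eq_vec3; rewrite vec3K.
have [|phi [ca sb]] := @circle_angle (x 0 0 / sin t) (x 0 1 / sin t).
  by rewrite !expr_div_n -mulrDl st2 divff // expf_neq0.
exists phi, t; rewrite t0; split => //; rewrite geod_dir -ca -sb.
by apply: eq_vec3; rewrite vec3K // mulrC divfK.
Qed.

(** The point at distance of cotangent [q] from the pole. With this parameter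
    the equator is at 0, and the points above the tangent circle become
    [tangent_dir phi + q *: pole] up to a positive factor, so that convex
    combinations are linear in [q]. *)
Definition cot_point phi q := geod (tangent_dir phi) (pi / 2 - atan q).

Lemma cot_pointE phi q :
  cot_point phi q = cos (atan q) *: vec3 (cos phi) (sin phi) q.
Proof.
rewrite /cot_point geod_dir sin_pihalfB cos_pihalfB.
have -> : sin (atan q) = cos (atan q) * q.
  have c0 : cos (atan q) != 0.
    by apply/lt0r_neq0/cos_gt0_pihalf; rewrite atan_gtNpi2 atan_ltpi2.
  by rewrite -{3}(atanK q) /tan mulrC divfK.
by apply: eq_vec3; rewrite !mxE.
Qed.

Lemma cos_atan_gt0 (q : R) : 0 < cos (atan q).
Proof. by apply: cos_gt0_pihalf; rewrite atan_gtNpi2 atan_ltpi2. Qed.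

Lemma cot_point_hemisphere phi q : 0 <= q -> hemisphere (cot_point phi q).
Proof.
move=> q0; apply: geod_hemisphere.
have := atan_ltpi2 q; have := le_atan q0; rewrite atan0.
by have := @pihalf_gt0 R; move=> h1 h2 h3; apply/andP; split; lra.
Qed.

Lemma continuous_row3 (h : R -> 'rV[R]_3) :
  continuous (fun t => h t 0 0) -> continuous (fun t => h t 0 1) ->
  continuous (fun t => h t 0 2) -> continuous h.
Proof.
move=> c0 c1 c2.
pose g t := h t 0 0 *: vec3 1 0 0 + h t 0 1 *: vec3 0 1 0 + h t 0 2 *: vec3 0 0 1.
have -> : h = g by apply/funext => s; apply: eq_vec3; rewrite !mxE /=; ring.
move=> t; apply: cvgD; first apply: cvgD.
- by apply: cvgZr_tmp; exact: c0.
- by apply: cvgZr_tmp; exact: c1.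
- by apply: cvgZr_tmp; exact: c2.
Qed.

Lemma continuous_geod phi : continuous (geod (tangent_dir phi)).
Proof.
apply: continuous_row3.
- rewrite (_ : (fun _ => _) = fun t => sin t * cos phi); last first.
    by apply/funext => t; rewrite geod_dir vec3K.
  by move=> t; apply: cvgM; [exact: continuous_sin|exact: cvg_cst].
- rewrite (_ : (fun _ => _) = fun t => sin t * sin phi); last first.
    by apply/funext => t; rewrite geod_dir vec3K.
  by move=> t; apply: cvgM; [exact: continuous_sin|exact: cvg_cst].
- rewrite (_ : (fun _ => _) = @cos R); first exact: continuous_cos.
  by apply/funext => t; rewrite geod_dir vec3K.
Qed.

Lemma continuous_dir t : continuous (fun phi => geod (tangent_dir phi) t).
Proof.
apply: continuous_row3.
- rewrite (_ : (fun _ => _) = fun phi => sin t * cos phi); last first.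
    by apply/funext => phi; rewrite geod_dir vec3K.
  by move=> phi; apply: cvgM; [exact: cvg_cst|exact: continuous_cos].
- rewrite (_ : (fun _ => _) = fun phi => sin t * sin phi); last first.
    by apply/funext => phi; rewrite geod_dir vec3K.
  by move=> phi; apply: cvgM; [exact: cvg_cst|exact: continuous_sin].
- rewrite (_ : (fun _ => _) = fun _ => cos t); first by move=> phi; exact: cvg_cst.
  by apply/funext => phi; rewrite geod_dir vec3K.
Qed.

(** The cone over a convex set is closed under nonnegative combinations. *)
Lemma sph_convex_comb (K : set 'rV[R]_3) x y z a b k : sph_convex K ->
  K x -> K y -> hemisphere z -> 0 <= a -> 0 <= b -> 0 < a + b -> 0 < k ->
  a *: x + b *: y = k *: z -> K z.
Proof.
move=> [C [cC sC] ->] [_ Cx] [_ Cy] hz a0 b0 ab0 k0 e; split => //.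
have -> : z = k^-1 *: (a *: x + b *: y).
  by rewrite e scalerA mulVf ?scale1r // lt0r_neq0.
apply: (sC); first by rewrite invr_gt0.
have -> : a *: x + b *: y =
    (a + b) *: ((a / (a + b)) *: x + (1 - a / (a + b)) *: y).
  rewrite scalerDr !scalerA mulrBr mulr1 mulrC divfK ?lt0r_neq0 //.
  by rewrite addrAC subrr add0r.
apply: (sC) => //.
have l0 : 0 <= a / (a + b) by rewrite divr_ge0 // ltW.
have l1 : a / (a + b) <= 1 by rewrite ler_pdivrMr // mul1r lerDl.
by have := cC x y (Itv01 l0 l1); rewrite !inE => /(_ Cx Cy).
Qed.

End SphereVectors.

(** * The radial function of a symmetric body *)

Section RadialFunction.
Context {R : realType}.
Variable K : set 'rV[R]_3.
Hypotheses (K_body : convex_body K) (K_sym : origin_symmetric K).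
Implicit Types (q t s phi : R).

Let pih0 : 0 < pi / 2 :> R. Proof. exact: pihalf_gt0. Qed.
Let pi2 : pi = pi / 2 + pi / 2 :> R. Proof. exact: pi_split. Qed.

Let K_convex : sph_convex K. Proof. by have [] := K_body. Qed.
Let K_closed : closed K. Proof. by have [] := K_body. Qed.

Lemma body_hemisphere : K `<=` hemisphere.
Proof. by move: K_convex => [C _ ->] x []. Qed.

Definition rho phi := radial K (tangent_dir phi).

Definition ray phi : set R := [set t | 0 <= t <= pi / 2 /\ K (geod (tangent_dir phi) t)].

Lemma sdist_geod phi t : 0 <= t <= pi / 2 -> sdist (geod (tangent_dir phi) t) pole = t.
Proof.
move=> /andP[t0 th]; rewrite /sdist dot_pole geod_dir2 cosK // in_itv /=.
by apply/andP; split; lra.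
Qed.

Lemma rhoE phi : rho phi = sup (ray phi).
Proof.
rewrite /rho /radial; congr sup; apply/seteqP; split => [t|t [tI Kt]].
  move=> [x [Kx [s]]]; rewrite /= in_itv /= => sI sx <-.
  by rewrite -sx sdist_geod //; split => //; rewrite sx.
exists (geod (tangent_dir phi) t); last exact: sdist_geod.
by split => //; exists t => //=; rewrite in_itv.
Qed.

Lemma rhoDpi phi : rho (phi + pi) = rho phi.
Proof.
by rewrite /rho tangent_dirDpi -K_sym //; exact: tangent_dir_tangent.
Qed.

Let ray_ub phi : ubound (ray phi) (pi / 2).
Proof. by move=> t [/andP[]]. Qed.

Lemma rho_ge t phi : 0 <= t <= pi / 2 -> K (geod (tangent_dir phi) t) -> t <= rho phi.
Proof. by move=> tI Kt; rewrite rhoE; apply: ub_le_sup => //; exists (pi / 2). Qed.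

(** The given interior point may be the pole or lie on the equator; sliding it
    along its ray moves it off both, and its distance to the pole is then shared
    by points of the body in all nearby directions. *)
Lemma interior_arc : exists phi0 s d, [/\ 0 < s < pi / 2, 0 < d &
  forall phi, `|phi - phi0| < d -> K (geod (tangent_dir phi) s)].
Proof.
have [_ _ [x [sx nx]]] := K_body.
have Kx : K x by exact: (nbhs_singleton nx).
have [phi0 [t0 [/andP[t00 t0h] xE]]] := polar_coordinates (body_hemisphere Kx).
have : nbhs x [set y | sphere y -> K y] by [].
rewrite xE nbhsE => -[U [oU Ux] UK].
have near_t : nbhs t0 (geod (tangent_dir phi0) @^-1` U).
  by apply: continuous_geod; exact: open_nbhs_nbhs.
have [e /= e0 he] := (nbhs_ballP _ _).1 near_t.
have [s [sI sU]] : exists s, 0 < s < pi / 2 /\ `|t0 - s| < e.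
  pose d := Num.min e (pi / 4) / 2.
  have p4 : 0 < pi / 4 :> R by rewrite divr_gt0 ?pi_gt0.
  have d0 : 0 < d by rewrite divr_gt0 // lt_min e0 p4.
  have de : d < e.
    have : Num.min e (pi / 4) <= e by rewrite ge_min lexx.
    by rewrite /d; lra.
  have dh : d <= pi / 8.
    have : Num.min e (pi / 4) <= pi / 4 by rewrite ge_min lexx orbT.
    by rewrite /d; lra.
  have [h|h] := leP t0 (pi / 4).
    exists (t0 + d); split; first by apply/andP; split; lra.
    by rewrite opprD addNKr normrN gtr0_norm.
  exists (t0 - d); split; first by apply/andP; split; lra.
  by rewrite opprB addrCA subrr addr0 gtr0_norm.
have Us : U (geod (tangent_dir phi0) s) by exact: he.
have near_phi : nbhs phi0 ((fun phi => geod (tangent_dir phi) s) @^-1` U).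
  by apply: continuous_dir; exact: open_nbhs_nbhs.
have [r /= r0 hr] := (nbhs_ballP _ _).1 near_phi.
exists phi0, s, r; split => // phi; rewrite distrC => /hr Uphi.
by apply: UK => //; exact: geod_sphere.
Qed.

(** By symmetry the body has points on two opposite rays, other than the pole,
    and the pole lies between them. *)
Lemma pole_body : K pole.
Proof.
have [phi0 [s [d [/andP[s0 sh] d0 Ks]]]] := interior_arc.
have {}Ks : K (geod (tangent_dir phi0) s) by apply: Ks; rewrite subrr normr0.
have rs : s <= rho phi0 by apply: rho_ge => //; rewrite !ltW.
have : 0 < rho (phi0 + pi) by rewrite rhoDpi; exact: lt_le_trans rs.
rewrite rhoE; have [->|/set0P ne] := eqVneq (ray (phi0 + pi)) set0.
  by rewrite sup0 ltxx.
move=> /(sup_gt ne)[t [/andP[t0 th] Kt] tp].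
have s1 : 0 < sin s by apply: sin_gt0_pihalfW; rewrite s0 ltW.
have t1 : 0 < sin t by apply: sin_gt0_pihalfW; rewrite tp.
apply: (sph_convex_comb K_convex Ks Kt _ (ltW t1) (ltW s1) (k := sin (s + t))).
- by rewrite -(geod0 (tangent_dir 0)); apply: geod_hemisphere; rewrite oppr_le0 !ltW.
- exact: addr_gt0.
- by apply: sin_gt0_pi; apply/andP; split; lra.
rewrite tangent_dirDpi /geod sinD; apply: eq_vec3; rewrite !mxE /=; ring.
Qed.

Lemma ray_down phi s t : 0 <= s -> s <= t -> t <= pi / 2 ->
  K (geod (tangent_dir phi) t) -> K (geod (tangent_dir phi) s).
Proof.
move=> s0; rewrite le_eqVlt => /predU1P[->//|st] th Kt.
have t1 : 0 < sin t by apply: sin_gt0_pihalfW; rewrite (le_lt_trans s0).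
have s1 : 0 <= sin s by apply: sin_ge0_pihalf; rewrite s0 (le_trans (ltW st)).
have d1 : 0 < sin (t - s).
  by apply: sin_gt0_pihalfW; apply/andP; split; lra.
apply: (sph_convex_comb K_convex Kt pole_body _ s1 (ltW d1) _ t1).
- by apply: geod_hemisphere; apply/andP; split; lra.
- exact: ltr_wpDl.
rewrite sinB /geod; apply: eq_vec3; rewrite !mxE /=; ring.
Qed.

Lemma ray_nonempty phi : ray phi !=set0.
Proof. by exists 0; split; rewrite ?lexx ?ltW // geod0; exact: pole_body. Qed.

Lemma rho_itv phi : 0 <= rho phi <= pi / 2.
Proof.
apply/andP; split.
  by apply: rho_ge; [rewrite lexx ltW|rewrite geod0; exact: pole_body].
rewrite rhoE; exact: (ge_sup (ray_nonempty phi) (@ray_ub phi)).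
Qed.

Lemma rho_mem phi : K (geod (tangent_dir phi) (rho phi)).
Proof.
have cl : closed (ray phi).
  rewrite (_ : ray phi = `[0, pi / 2]%classic `&` geod (tangent_dir phi) @^-1` K).
    apply: closedI; first exact: interval_closed.
    by apply: preimage_closed => // x _; exact: continuous_geod.
  by apply/seteqP; split => t /=; rewrite in_itv.
have : closure (ray phi) (sup (ray phi)).
  by apply: closure_sup; [exact: ray_nonempty|exists (pi / 2)].
by rewrite -(closure_id _).1 // -rhoE => -[].
Qed.

Lemma mem_body t phi : 0 <= t <= pi / 2 ->
  K (geod (tangent_dir phi) t) <-> t <= rho phi.
Proof.
move=> tI; split; first exact: rho_ge.
case/andP: tI (rho_itv phi) => t0 _ /andP[_ rh] tr.
exact: ray_down t0 tr rh (rho_mem phi).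
Qed.

End RadialFunction.

(** * Gauges restricted to the circle *)

Section TrigonometricConvexity.
Context {R : realType}.
Implicit Types (a b c x y q T M : R) (g h : R -> R).

Lemma periodic_int h T x (n : int) : (forall y, h (y + T) = h y) ->
  h (x + T *~ n) = h x.
Proof.
move=> ph; have pn m y : h (y + T *+ m) = h y.
  by elim: m => [|m IH]; rewrite ?mulr0n ?addr0 // mulrSr addrA ph.
case: n => m; first by rewrite -pmulrn pn.
by rewrite NegzE mulrNz -pmulrn -[in RHS](subrK (T *+ m.+1) x) pn.
Qed.

Lemma periodic_reduce h T c x : 0 < T -> (forall y, h (y + T) = h y) ->
  exists2 y, c <= y <= c + T & h x = h y.
Proof.
move=> T0 ph; pose n := Num.floor ((x - c) / T).
exists (x + T *~ (- n)); last by rewrite periodic_int.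
have h1 : n%:~R * T <= x - c by rewrite -ler_pdivlMr // floor_le_tmp.
have h2 : x - c < (n + 1)%:~R * T by rewrite -ltr_pdivrMr // floorD1_gt.
rewrite mulrNz -(mulrzr T) (mulrC T).
by move: h2; rewrite intrD mulrDl mul1r => h2; apply/andP; split; lra.
Qed.

(** For the gauge of a planar convex set, read on the unit circle, this is
    sublinearity: the unit vectors [u] satisfy
    [sin (b - a) *: u x = sin (b - x) *: u a + sin (x - a) *: u b]. *)
Definition trig_convex g := forall a b x, a <= x <= b -> a < b -> b < a + pi ->
  g x * sin (b - a) <= sin (b - x) * g a + sin (x - a) * g b.

Lemma trig_convexN g : trig_convex g -> trig_convex (fun x => g (- x)).
Proof.
move=> tg a b x /andP[ax xb] ab bp.
have c1 : - b <= - x <= - a by rewrite !lerN2 xb ax.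
have c2 : - b < - a by rewrite ltrN2.
have c3 : - a < - b + pi by lra.
have := tg (- b) (- a) (- x) c1 c2 c3.
have -> : - a - - b = b - a by ring.
have -> : - a - - x = x - a by ring.
have -> : - x - - b = b - x by ring.
by rewrite [X in _ <= X -> _]addrC.
Qed.

Section CosineLipschitz.
Variables (M : R) (g : R -> R).
Hypotheses (M_gt0 : 0 < M) (g_itv : forall x, 0 <= g x <= M).

Definition slope_angle x := acos (g x / M).

Lemma slope_ratio x : 0 <= g x / M <= 1.
Proof.
have /andP[g0 gM] := g_itv x.
by rewrite divr_ge0 ?(ltW M_gt0) // ler_pdivrMr // mul1r.
Qed.

Lemma slope_ratioW x : -1 <= g x / M <= 1.
Proof. by have /andP[h ->] := slope_ratio x; rewrite (le_trans _ h) // lerN10. Qed.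

Lemma cos_slope_angle x : cos (slope_angle x) = g x / M.
Proof. by rewrite acosK // in_itv /= slope_ratioW. Qed.

Lemma slope_angle_itv x : 0 <= slope_angle x <= pi / 2.
Proof.
rewrite acos_ge0 ?slope_ratioW //= leNgt; apply/negP => h.
have : cos (slope_angle x) < cos (pi / 2).
  have h1 := @pihalf_gt0 R; have h2 := @pi_split R.
  rewrite ltr_cos // in_itv /=; first by apply/andP; split; lra.
  by rewrite acos_ge0 ?acos_lepi ?slope_ratioW.
by rewrite cos_pihalf cos_slope_angle ltNge; case/andP: (slope_ratio x) => ->.
Qed.

Lemma slope_angle_right x y : trig_convex g -> x <= y ->
  slope_angle y <= slope_angle x + (y - x).
Proof.
move=> tg; rewrite le_eqVlt => /predU1P[->|xy]; first by rewrite subrr addr0.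
have h1 := @pihalf_gt0 R; have h2 := @pi_split R.
have /andP[px0 pxh] := slope_angle_itv x; have /andP[py0 pyh] := slope_angle_itv y.
(* [al] replaces the angle at [x], which may vanish: the chord must not be
   degenerate *)
apply/ler_addgt0Pr => e e0.
pose al := slope_angle x + e; pose d := y - x.
have d0 : 0 < d by rewrite subr_gt0.
have yE : y = x + d by rewrite /d addrC subrK.
have al0 : 0 < al by rewrite /al; lra.
rewrite -addrA (addrC (y - x)) addrA -/al -/d.
have [h|h] := leP (pi / 2) (al + d); first exact: le_trans pyh h.
have gx : M * cos al <= g x.
  have -> : g x = M * cos (slope_angle x) by rewrite cos_slope_angle mulrC divfK ?lt0r_neq0.
  have al_itv : 0 <= al <= pi / 2 by apply/andP; split; lra.
  by rewrite ler_pM2l // ler_cos_pihalf ?px0 // /al lerDl ltW.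
have := tg (x - al) y x.
have -> : y - (x - al) = d + al by rewrite /d; ring.
have -> : x - (x - al) = al by ring.
rewrite -/d => conv.
have ga : g (x - al) <= M by case/andP: (g_itv (x - al)).
have sal : 0 < sin al by apply: sin_gt0_pihalfW; apply/andP; split; lra.
have sd : 0 < sin d by apply: sin_gt0_pihalfW; apply/andP; split; lra.
have sda : 0 < sin (d + al) by apply: sin_gt0_pihalfW; apply/andP; split; lra.
have gy : M * cos (al + d) <= g y.
  rewrite -(ler_pM2l sal).
  have c1 : g x * sin (d + al) <= sin d * g (x - al) + sin al * g y.
    by apply: conv; [apply/andP; split; lra|lra|lra].
  have c2 : M * cos al * sin (d + al) <= g x * sin (d + al) by rewrite ler_pM2r.
  have c3 : sin d * g (x - al) <= sin d * M by rewrite ler_pM2l.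
  have c4 : sin al * (M * cos (al + d)) = M * cos al * sin (d + al) - sin d * M.
    have s2 := cos2Dsin2 al.
    rewrite (_ : sin d * M = sin d * M * (cos al ^+ 2 + sin al ^+ 2)); last first.
      by rewrite s2 mulr1.
    rewrite cosD sinD; ring.
  lra.
rewrite -ler_cos_pihalf ?slope_angle_itv //; last by apply/andP; split; lra.
by rewrite cos_slope_angle ler_pdivlMr // mulrC.
Qed.

End CosineLipschitz.

(** Apply [trig_convex] at [x] between the point at distance [slope_angle x] on
    its left, where [g] is at most [M], and a point [y] on its right: the
    resulting lower bound for [g y] is [M * cos] of the sum of the angle at [x]
    and [y - x]. The left bound follows by reflection. *)
Lemma slope_angle_lipschitz M g : 0 < M -> (forall x, 0 <= g x <= M) ->
  trig_convex g -> forall x y, `|slope_angle M g x - slope_angle M g y| <= `|x - y|.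
Proof.
move=> M0 g01 tg.
have right x y : x <= y -> slope_angle M g y <= slope_angle M g x + (y - x).
  exact: slope_angle_right.
have left x y : x <= y -> slope_angle M g x <= slope_angle M g y + (y - x).
  move=> xy; have := @slope_angle_right M (fun x => g (- x)) M0 (fun x => g01 (- x))
    (- y) (- x) (trig_convexN tg).
  rewrite lerN2 => /(_ xy); rewrite /slope_angle !opprK; lra.
move=> x y; wlog xy : x y / x <= y.
  move=> h; have [|/ltW] := leP x y; first exact: h.
  by move=> /h; rewrite distrC (distrC y).
rewrite [leRHS]distrC [leRHS]ger0_norm ?subr_ge0 // ler_norml.
have := right x y xy; have := left x y xy => h1 h2; apply/andP; split; lra.
Qed.

End TrigonometricConvexity.

(** * The gauge of a symmetric body *)

Section BodySlope.
Context {R : realType}.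
Variable K : set 'rV[R]_3.
Hypotheses (K_body : convex_body K) (K_sym : origin_symmetric K).
Implicit Types (a b q t s x phi : R).

Let pih0 : 0 < pi / 2 :> R. Proof. exact: pihalf_gt0. Qed.
Let pi2 : pi = pi / 2 + pi / 2 :> R. Proof. exact: pi_split. Qed.

Let K_convex : sph_convex K. Proof. by have [] := K_body. Qed.

Lemma cot_angle_itv q : 0 <= q -> 0 < pi / 2 - atan q <= pi / 2.
Proof.
move=> q0; have := atan_ltpi2 q; have := le_atan q0; rewrite atan0 => h1 h2.
by apply/andP; split; lra.
Qed.

Lemma cot_point_conv a b x q1 q2 : a <= x <= b -> a < b -> b < a + pi ->
  0 <= q1 -> 0 <= q2 -> K (cot_point a q1) -> K (cot_point b q2) ->
  K (cot_point x ((sin (b - x) * q1 + sin (x - a) * q2) / sin (b - a))).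
Proof.
move=> /andP[ax xb] ab bp q10 q20 K1 K2; set q := (_ / _).
have s0 : 0 < sin (b - a) by apply: sin_gt0_pi; apply/andP; split; lra.
have s1 : 0 <= sin (b - x) by apply: sin_ge0_pi; apply/andP; split; lra.
have s2 : 0 <= sin (x - a) by apply: sin_ge0_pi; apply/andP; split; lra.
have s12 : 0 < sin (b - x) \/ 0 < sin (x - a).
  have [xa|xa] := leP x a.
    by left; apply: sin_gt0_pi; apply/andP; split; lra.
  by right; apply: sin_gt0_pi; apply/andP; split; lra.
have q0 : 0 <= q by rewrite divr_ge0 ?(ltW s0) // addr_ge0 // mulr_ge0.
have c0 := cos_atan_gt0 q; have c1 := cos_atan_gt0 q1; have c2 := cos_atan_gt0 q2.
apply: (@sph_convex_comb _ _ _ _ _ (sin (b - x) / cos (atan q1))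
  (sin (x - a) / cos (atan q2)) (sin (b - a) / cos (atan q)) K_convex K1 K2).
- exact: cot_point_hemisphere.
- by rewrite divr_ge0 // ltW.
- by rewrite divr_ge0 // ltW.
- case: s12 => s; first by rewrite ltr_wpDr ?divr_gt0 ?divr_ge0 // ltW.
  by rewrite ltr_wpDl ?divr_gt0 ?divr_ge0 // ltW.
- by rewrite divr_gt0.
rewrite !cot_pointE !scalerA !divfK ?lt0r_neq0 //.
have qE : sin (b - a) * q = sin (b - x) * q1 + sin (x - a) * q2.
  by rewrite /q mulrC divfK // lt0r_neq0.
apply: eq_vec3; rewrite !mxE /= ?qE // !sinB; ring.
Qed.

Lemma mem_cot_point phi q : 0 <= q ->
  K (cot_point phi q) <-> pi / 2 - atan q <= rho K phi.
Proof.
move=> q0; apply: mem_body => //.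
by have /andP[/ltW -> ->] := cot_angle_itv q0.
Qed.

(** The pole is an interior point. The body has points at a common distance
    from the pole in two opposite arcs of directions, and convexity extends this
    to the remaining directions. *)
Lemma rho_lower : exists2 Q, 0 <= Q & forall phi, pi / 2 - atan Q <= rho K phi.
Proof.
have [phi0 [s [d [/andP[s0 sh] d0 Ks]]]] := interior_arc K_body.
pose eta := Num.min d (pi / 2) / 2.
have eta0 : 0 < eta by rewrite divr_gt0 // lt_min d0.
have etad : eta < d.
  have : Num.min d (pi / 2) <= d by rewrite ge_min lexx.
  by rewrite /eta; lra.
have etah : eta <= pi / 4.
  have : Num.min d (pi / 2) <= pi / 2 by rewrite ge_min lexx orbT.
  by rewrite /eta; lra.
pose qs := tan (pi / 2 - s).
have qsE : pi / 2 - atan qs = s.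
  by rewrite tanK ?in_itv /=; [ring|apply/andP; split; lra].
have qs0 : 0 <= qs.
  by rewrite /qs /tan divr_ge0 // ?sin_pihalfB ?cos_pihalfB;
    [apply: cos_ge0_pihalfW|apply: sin_ge0_pihalf]; rewrite !ltW.
have se : 0 < sin eta by apply: sin_gt0_pihalf; apply/andP; split; lra.
pose Q := 2 * qs / sin eta.
have Q0 : 0 <= Q by rewrite divr_ge0 ?(ltW se) // mulr_ge0.
have arc phi : `|phi - phi0| < d -> K (cot_point phi qs).
  by move=> /Ks; rewrite /cot_point qsE.
have arc' phi : `|phi - phi0| < d -> K (cot_point (phi + pi) qs).
  move=> /arc; rewrite !mem_cot_point // => h.
  by rewrite rhoDpi.
(* the two arcs leave gaps shorter than a half-turn, filled by convexity *)
have fill a b x : a <= x <= b -> b - a = pi - eta ->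
    K (cot_point a qs) -> K (cot_point b qs) -> pi / 2 - atan Q <= rho K x.
  move=> axb ba Ka Kb.
  have ab : a < b by lra.
  have bp : b < a + pi by lra.
  have := cot_point_conv axb ab bp qs0 qs0 Ka Kb.
  have -> : sin (b - a) = sin eta.
    by rewrite ba sinB sinpi cospi; ring.
  set q := (_ / _) => Kq.
  have qQ : q <= Q.
    rewrite ler_pM2r ?invr_gt0 // -mulrDl; apply: ler_wpM2r => //.
    by rewrite -[2]/(1 + 1); apply: lerD; exact: sin_le1.
  have q0 : 0 <= q.
    case/andP: axb => ax xb.
    apply: divr_ge0; last exact: ltW.
    by apply: addr_ge0; apply: mulr_ge0 => //; apply: sin_ge0_pi; apply/andP; split; lra.
  apply: le_trans ((mem_cot_point x q0).1 Kq).
  by rewrite lerD2l lerN2; exact: le_atan.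
exists Q => // phi.
have [y /andP[y0 y1] ->] := @periodic_reduce _ (rho K) pi phi0 phi (pi_gt0 R) (rhoDpi K_sym).
have K0 : K (cot_point phi0 qs) by apply: arc; rewrite subrr normr0.
have K0' : K (cot_point (phi0 + pi) qs) by apply: arc'; rewrite subrr normr0.
have Ke : K (cot_point (phi0 + eta) qs).
  by apply: arc; rewrite addrAC subrr add0r gtr0_norm.
have Ke' : K (cot_point (phi0 - eta + pi) qs).
  by apply: arc'; rewrite addrAC subrr add0r normrN gtr0_norm.
have [h|h] := leP y (phi0 - eta + pi).
  by apply: (fill phi0 (phi0 - eta + pi)) => //; [rewrite y0|ring].
apply: (fill (phi0 + eta) (phi0 + pi)) => //; [apply/andP; split; lra|ring].
Qed.

(** The cotangent of the radial function: the gauge of the gnomonic image of the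
    body, which vanishes in the directions where the body reaches the equator. *)
Definition slope phi := tan (pi / 2 - rho K phi).

Lemma rho_gt0 phi : 0 < rho K phi.
Proof.
have [Q Q0 hQ] := rho_lower; apply: lt_le_trans (hQ phi).
by case/andP: (cot_angle_itv Q0).
Qed.

Lemma rho_le phi : rho K phi <= pi / 2.
Proof. by case/andP: (rho_itv K_body K_sym phi). Qed.

Lemma atan_slope phi : atan (slope phi) = pi / 2 - rho K phi.
Proof.
have h1 := rho_gt0 phi; have h2 := rho_le phi.
by rewrite tanK // in_itv /=; apply/andP; split; lra.
Qed.

Lemma rho_slope phi : rho K phi = pi / 2 - atan (slope phi).
Proof. by rewrite atan_slope opprB addrC subrK. Qed.

Lemma slope_ge0 phi : 0 <= slope phi.
Proof.
rewrite leNgt; apply/negP => /lt_atan; rewrite atan0 atan_slope.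
by have := rho_le phi; lra.
Qed.

Lemma mem_slope phi q : 0 <= q -> K (cot_point phi q) <-> slope phi <= q.
Proof.
move=> q0; rewrite mem_cot_point // rho_slope lerD2l lerN2; split; last exact: le_atan.
by move=> h; rewrite leNgt; apply/negP => /lt_atan; rewrite ltNge h.
Qed.

Lemma slopeDpi phi : slope (phi + pi) = slope phi.
Proof. by rewrite /slope rhoDpi. Qed.

Lemma slope_trig_convex : trig_convex slope.
Proof.
move=> a b x axb ab bp; have /andP[ax xb] := axb.
have s0 : 0 < sin (b - a) by apply: sin_gt0_pi; apply/andP; split; lra.
have Ka : K (cot_point a (slope a)) by apply/mem_slope => //; exact: slope_ge0.
have Kb : K (cot_point b (slope b)) by apply/mem_slope => //; exact: slope_ge0.
have := cot_point_conv axb ab bp (slope_ge0 a) (slope_ge0 b) Ka Kb.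
set q := (_ / _) => Kq; have q0 : 0 <= q.
  apply: divr_ge0; last exact: ltW.
  by apply: addr_ge0; apply: mulr_ge0; rewrite ?slope_ge0 //;
    apply: sin_ge0_pi; apply/andP; split; lra.
by rewrite -ler_pdivlMr //; exact: (mem_slope x q0).1 Kq.
Qed.

Lemma slope_bounded : exists2 Q, 0 < Q & forall phi, slope phi <= Q.
Proof.
have [Q Q0 hQ] := rho_lower; exists (Q + 1); first by rewrite ltr_wpDl.
move=> phi; apply: (@le_trans _ _ Q); last by rewrite lerDl.
by apply/mem_slope => //; apply/mem_cot_point.
Qed.

Lemma slope_max : exists2 theta, 0 <= theta <= pi & forall phi, slope phi <= slope theta.
Proof.
have [Q Q0 hQ] := slope_bounded.
have g01 x : 0 <= slope x <= Q by rewrite slope_ge0 hQ.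
have lip := slope_angle_lipschitz Q0 g01 slope_trig_convex.
have cont : continuous slope.
  have -> : slope = fun x => Q * cos (slope_angle Q slope x).
    by apply/funext => x; rewrite cos_slope_angle // mulrC divfK // lt0r_neq0.
  move=> x; apply: cvgM; first exact: cvg_cst.
  apply: (@continuous_comp _ _ _ (slope_angle Q slope) (@cos R)).
    exact: lipschitz1_continuous.
  exact: continuous_cos.
have [|theta tI tmax] := @EVT_max R slope 0 pi (pi_ge0 R).
  exact: continuous_subspaceT.
exists theta; first by move: tI; rewrite in_itv.
move=> phi; have := @periodic_reduce _ slope pi 0 phi (pi_gt0 R) slopeDpi.
by rewrite add0r => -[y yI ->]; apply: tmax; rewrite in_itv.
Qed.

(** A body that reaches the equator in every direction is the hemisphere. *)
Lemma slope_max_gt0 theta : K <> hemisphere ->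
  (forall phi, slope phi <= slope theta) -> 0 < slope theta.
Proof.
move=> K_neq tmax; rewrite lt_def slope_ge0 andbT; apply/eqP => t0.
apply: K_neq; apply/seteqP; split; first exact: body_hemisphere.
move=> x /polar_coordinates[phi [t [tI ->]]]; apply/mem_body => //.
have -> : rho K phi = pi / 2.
  have s0 : slope phi = 0 by apply/eqP; rewrite eq_le slope_ge0 -[leRHS]t0 tmax.
  by rewrite rho_slope s0 atan0 subr0.
by case/andP: tI.
Qed.

End BodySlope.

(** * Area and chords of a symmetric body *)

Section BodyIntegrals.
Context {R : realType}.
Notation mu := (@lebesgue_measure R).
Variable K : set 'rV[R]_3.
Hypotheses (K_body : convex_body K) (K_sym : origin_symmetric K).
Hypothesis K_neq : K <> hemisphere.
Variable theta : R.
Hypothesis theta_itv : 0 <= theta <= pi.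
Hypothesis theta_max : forall phi, slope K phi <= slope K theta.

Let pih0 : 0 < pi / 2 :> R. Proof. exact: pihalf_gt0. Qed.

Definition max_slope := slope K theta.

Lemma max_slope_gt0 : 0 < max_slope.
Proof. exact: slope_max_gt0. Qed.

Lemma slope_itv phi : 0 <= slope K phi <= max_slope.
Proof. by rewrite slope_ge0 //= theta_max. Qed.

(** Directions are counted from [theta], where the boundary of the body is
    nearest to the pole. *)
Definition body_angle x := slope_angle max_slope (slope K) (x + theta).

Lemma body_angle_lipschitz x y : `|body_angle x - body_angle y| <= `|x - y|.
Proof.
have := slope_angle_lipschitz max_slope_gt0 slope_itv (slope_trig_convex K_body K_sym).
move=> /(_ (x + theta) (y + theta)).
by rewrite opprD addrACA subrr addr0.
Qed.

Lemma body_angle_itv x : 0 <= body_angle x <= pi / 2.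
Proof. exact: (slope_angle_itv max_slope_gt0 slope_itv). Qed.

Lemma cos_body_angle x : max_slope * cos (body_angle x) = slope K (x + theta).
Proof.
rewrite cos_slope_angle; [|exact: max_slope_gt0|exact: slope_itv].
by rewrite mulrC divfK // lt0r_neq0 // max_slope_gt0.
Qed.

Lemma body_angle0 : body_angle 0 = 0.
Proof. by rewrite /body_angle /slope_angle add0r divff ?acos1 // lt0r_neq0 // max_slope_gt0. Qed.

Lemma body_anglepi : body_angle pi = 0.
Proof.
rewrite /body_angle /slope_angle addrC slopeDpi // divff ?acos1 //.
by rewrite lt0r_neq0 // max_slope_gt0.
Qed.

Lemma body_radiusE x : body_radius max_slope body_angle x = rho K (x + theta).
Proof. by rewrite /body_radius /strip_radius cos_body_angle -rho_slope. Qed.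

Lemma continuous_rho : continuous (rho K).
Proof.
have -> : rho K = fun x => body_radius max_slope body_angle (x - theta).
  by apply/funext => x; rewrite body_radiusE subrK.
apply: (@continuous_shift _ (body_radius max_slope body_angle)).
by apply: continuous_strip_radius; apply: lipschitz1_continuous; exact: body_angle_lipschitz.
Qed.

(** By symmetry the radial function has period [pi], so the starting direction
    of the integration is immaterial. *)
Lemma integral_rho (v : R -> R) c : 0 <= c <= pi -> continuous v ->
  \int[mu]_(x in `[0, 2 * pi]) v (rho K (x + c)) =
  2 * \int[mu]_(x in `[0, pi]) v (body_radius max_slope body_angle x).
Proof.
move=> cI cv.
have cvr : continuous (fun x => v (rho K x)).
  move=> x; apply: (@continuous_comp _ _ _ (rho K) v); last exact: cv.
  exact: continuous_rho.
have per x : v (rho K (x + pi)) = v (rho K x) by rewrite rhoDpi.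
have perc x : v (rho K (x + pi + c)) = v (rho K (x + c)).
  by rewrite addrAC per.
rewrite (@integral_period2 _ (fun x => v (rho K (x + c)))) ?pi_ge0 //; last first.
  exact: (@continuous_shift _ (fun x => v (rho K x))).
congr (_ * _); rewrite (@integral_period _ (fun x => v (rho K x))) //.
rewrite -(@integral_period _ (fun x => v (rho K x)) pi theta) //.
by apply: eq_Rintegral => x _; rewrite body_radiusE.
Qed.

Lemma area_body : area K = (2 * body_area max_slope body_angle)%:E.
Proof.
have cu : continuous (fun y : R => 1 - cos y).
  by apply: continuous_1mcos => x; exact: cvg_id.
have sin_cont : continuous (@sin R) by exact: continuous_sin.
transitivity (\int[mu]_(phi in `[0%R, (2 * pi)%R]) (1 - cos (rho K (phi + 0)))%:E)%E.
  apply: eq_integral => phi _; rewrite addr0.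
  rewrite -integral_sin; last by case/andP: (rho_itv K_body K_sym phi).
  rewrite -(integral_upto sin_cont (rho_itv K_body K_sym phi)).
  apply: eq_integral => r; rewrite inE /= in_itv /= => rI.
  rewrite indicE; congr (_ * (nat_of_bool _)%:R)%:E.
  by apply/idP/idP; rewrite inE mem_body.
rewrite EFin_integral; last first.
  move=> x; apply: (@continuous_comp _ _ _ (fun x => rho K (x + 0)) (fun y => 1 - cos y)).
    exact: (continuous_shift continuous_rho).
  exact: cu.
by rewrite (@integral_rho (fun y => 1 - cos y) 0) // lexx pi_ge0.
Qed.

Lemma line_length_body phi :
  line_length (tangent_dir phi) (K `&` perp (tangent_dir phi)) =
  (2 * rho K (phi + pi / 2))%:E.
Proof.
rewrite /line_length; set S := (X in lebesgue_measure X).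
set r := rho K (phi + pi / 2).
have /andP[r0 rh] : 0 <= r <= pi / 2 by exact: rho_itv.
have -> : S = `[- r, r]%classic.
  have mem (t : R) : 0 <= t <= pi / 2 ->
      K (geod (tangent_dir (phi + pi / 2)) t) <-> t <= r by move=> tI; exact: mem_body.
  have memN (t : R) : 0 <= t <= pi / 2 ->
      K (geod (tangent_dir (phi + pi / 2)) (- t)) <-> t <= r.
    move=> tI; rewrite -geod_dir_period opprK /r -rhoDpi //; exact: mem_body.
  apply/seteqP; split => t; rewrite /S /= in_itv /= quarter_turn_dir.
    move=> [/andP[t1 t2] [Kt _]]; apply/andP.
    have [t0|t0] := leP 0 t.
      have := (mem t _).1 Kt; rewrite t0 t2 => /(_ isT) tr; split => //.
      by rewrite (le_trans _ t0) // oppr_le0.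
    rewrite lerNl; split; last by rewrite (le_trans (ltW t0)).
    by apply: (memN (- t) _).1; rewrite ?opprK // oppr_ge0 ltW //= lerNl.
  move=> /andP[t1 t2].
  have th : - (pi / 2) <= t <= pi / 2.
    by rewrite (le_trans t2) // andbT (le_trans _ t1) // lerN2.
  split => //; split; last first.
    by split; [exact: geod_hemisphere|exact: geod_perp].
  have [t0|t0] := leP 0 t; first by apply/mem; rewrite // t0 (le_trans t2).
  rewrite -(opprK t); apply/memN; last by rewrite lerNl.
  by case/andP: th => h1 h2; rewrite oppr_ge0 ltW //= lerNl.
rewrite lebesgue_measure_itv /= lte_fin; case: ltP => h.
  by rewrite -EFinD opprK mulr2n mulrDl mul1r.
by rewrite (_ : r = 0) ?mulr0 //; lra.
Qed.

Lemma chord_square_body :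
  circle_integral (fun xi => line_length xi (K `&` perp xi) ^+ 2)%E =
  (8 * body_square max_slope body_angle)%:E.
Proof.
pose v (y : R) := (2 * y) ^+ 2.
have cv : continuous v.
  by apply: continuous_sqr => y; apply: cvgM; [exact: cvg_cst|exact: cvg_id].
transitivity (\int[mu]_(phi in `[0%R, (2 * pi)%R]) (v (rho K (phi + pi / 2)))%:E)%E.
  by apply: eq_integral => phi _; rewrite line_length_body /v -EFin_expe.
rewrite EFin_integral; last first.
  move=> x; apply: (@continuous_comp _ _ _ (fun x => rho K (x + pi / 2)) v).
    exact: (continuous_shift continuous_rho).
  exact: cv.
congr EFin; rewrite (@integral_rho v) //; last first.
  by have h := @pihalf_gt0 R; apply/andP; split; lra.
rewrite /body_square /v.
have -> : \int[mu]_(x in `[0, pi]) (2 * body_radius max_slope body_angle x) ^+ 2 =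
    \int[mu]_(x in `[0, pi]) (4 * (body_radius max_slope body_angle x) ^+ 2).
  by apply: eq_Rintegral => x _; ring.
rewrite RintegralZl //; first by ring.
apply: continuous_integrable; apply: continuous_sqr; apply: continuous_strip_radius.
by apply: lipschitz1_continuous; exact: body_angle_lipschitz.
Qed.

End BodyIntegrals.

(** * Topology of the sphere *)

Section SphereTopology.
Context {R : realType}.
Implicit Types (x y n : 'rV[R]_3).

Lemma continuous_dot n : continuous (fun x : 'rV[R]_3 => dot x n).
Proof.
have -> : (fun x : 'rV[R]_3 => dot x n) =
    fun x => x 0 0 * n 0 0 + x 0 1 * n 0 1 + x 0 2 * n 0 2.
  by apply/funext => x; rewrite dot3.
have c i : continuous (fun x : 'rV[R]_3 => x 0 i * n 0 i).
  by move=> x; exact: (cvgM (@coord_continuous R 1 3 0 i x) (cvg_cst _)).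
by move=> x; exact: (cvgD (cvgD (c 0 x) (c 1 x)) (c 2 x)).
Qed.

(** Moving from [x] along the great circle in the direction of [n]. *)
Lemma tilt x n (B : set 'rV[R]_3) : sphere x -> n != 0 -> dot x n = 0 -> nbhs x B ->
  exists y, [/\ B y, sphere y & 0 < dot y n].
Proof.
move=> sx n0 xn nB; have nn := dot_gt0 n0.
pose k := (Num.sqrt (dot n n))^-1.
have k0 : 0 < k by rewrite invr_gt0 sqrtr_gt0.
have kn : k ^+ 2 * dot n n = 1 by rewrite exprVn sqr_sqrtr ?mulVf ?lt0r_neq0 // ltW.
pose h (s : R) := cos s *: x + (k * sin s) *: n.
have ch : continuous h.
  have c (a b : R) : continuous (fun s => cos s * a + k * sin s * b).
    move=> s; apply: cvgD.
      by apply: cvgM; [exact: continuous_cos|exact: cvg_cst].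
    apply: cvgM; last exact: cvg_cst.
    by apply: cvgM; [exact: cvg_cst|exact: continuous_sin].
  have hE i : (fun s => h s 0 i) = fun s => cos s * x 0 i + k * sin s * n 0 i.
    by apply/funext => s; rewrite !mxE.
  by apply: continuous_row3; rewrite hE.
have h0 : h 0 = x by rewrite /h cos0 sin0 mulr0 scale1r scale0r addr0.
have nB' : nbhs (0 : R) (h @^-1` B) by apply: ch; rewrite h0.
have [e /= e0 he] := (nbhs_ballP _ _).1 nB'.
pose s := Num.min e 1 / 2.
have s0 : 0 < s by rewrite divr_gt0 // lt_min e0 ltr01.
have se : s < e.
  have : Num.min e 1 <= e by rewrite ge_min lexx.
  by rewrite /s; lra.
have s1 : s <= 1 / 2.
  have : Num.min e 1 <= 1 by rewrite ge_min lexx orbT.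
  by rewrite /s; lra.
have ss : 0 < sin s.
  apply: sin_gt0_pi; rewrite s0 /=; have := @pi_ge2 R; lra.
exists (h s); split.
- by apply: he; rewrite /ball /= sub0r normrN gtr0_norm.
- rewrite /sphere /= /h dotDl !dotZl (dotC _ (_ + _)) dotDl !dotZl.
  rewrite (dotC _ (_ + _)) dotDl !dotZl (dotC n x) xn.
  have sx' : dot x x = 1 := sx.
  rewrite sx' mulr1 !mulr0 addr0 add0r.
  transitivity (cos s ^+ 2 + sin s ^+ 2 * (k ^+ 2 * dot n n)); first ring.
  by rewrite kn mulr1 cos2Dsin2.
- rewrite /h dotDl !dotZl xn mulr0 add0r.
  by rewrite mulr_gt0 // mulr_gt0.
Qed.

Lemma open_hemisphere x : sph_interior hemisphere x <-> sphere x /\ 0 < x 0 2.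
Proof.
split=> [[sx nx]|[sx x2]].
  split=> //; have [_ hx] : hemisphere x by exact: (nbhs_singleton nx).
  rewrite lt_def -dot_pole hx andbT; apply/eqP => x2.
  have p0 : - (@pole R) != 0.
    rewrite oppr_eq0; apply/eqP => /rowP/(_ 2); rewrite !mxE /= => /eqP.
    by rewrite oner_eq0.
  have xp : dot x (- pole) = 0 by rewrite dotC -scaleN1r dotZl dotC x2 mulr0.
  have [y [By sy yp]] := tilt sx p0 xp nx.
  have [_ hy] := By sy.
  by move: yp; rewrite dotC -scaleN1r dotZl dotC mulN1r oppr_gt0 ltNge hy.
split=> //.
have : nbhs x ((fun y => dot y pole) @^-1` [set r | 0 < r]).
  apply: continuous_dot; rewrite dot_pole.
  by apply: open_nbhs_nbhs; split; [exact: open_gt|].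
by apply: filterS => y /= yp sy; split => //; exact: ltW.
Qed.

End SphereTopology.

(** * Lunes and strips *)

Section Lune.
Context {R : realType}.
Variable K : set 'rV[R]_3.
Hypotheses (K_body : convex_body K) (K_sym : origin_symmetric K).
Hypothesis K_neq : K <> hemisphere.
Variable theta : R.
Hypothesis theta_max : forall phi, slope K phi <= slope K theta.
Implicit Types (x y n v : 'rV[R]_3) (L : set 'rV[R]_3) (phi t : R).

Let M := max_slope K theta.
Let e : 'rV[R]_3 := tangent_dir theta.
Let psi := body_angle K theta.

Let M_gt0 : 0 < M. Proof. exact: max_slope_gt0. Qed.
Let K_closed : closed K. Proof. by have [] := K_body. Qed.
Let K_hemi : K `<=` hemisphere. Proof. exact: body_hemisphere. Qed.

Let psi_cos (u : R) : M * cos (psi u) = slope K (u + theta).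
Proof. exact: cos_body_angle. Qed.

Let gap (u : R) := cos (psi u) - `|cos u|.

Let gap_pi (u : R) : gap (u + pi) = gap u.
Proof.
rewrite /gap cosDpi normrN; congr (_ - _).
by apply: (mulfI (lt0r_neq0 M_gt0)); rewrite !psi_cos addrAC slopeDpi.
Qed.

Let slope_gap phi : slope K phi = M * (gap (phi - theta) + `|cos (phi - theta)|).
Proof. by rewrite /gap subrK psi_cos subrK. Qed.

Lemma slope_ge_strip phi : M * `|cos (phi - theta)| <= slope K phi.
Proof.
rewrite slope_gap ler_pM2l // lerDr.
have := @periodic_reduce _ gap pi 0 (phi - theta) (pi_gt0 R) gap_pi.
rewrite add0r => -[y yI ->]; rewrite subr_ge0.
apply: norm_cos_le yI.
- exact: body_angle_lipschitz.
- exact: body_angle_itv.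
- exact: body_angle0.
- exact: body_anglepi.
Qed.

(** The angle function of a strip, the case of equality. *)
Definition strip_like := forall u : R, 0 <= u <= pi -> cos (psi u) = `|cos u|.

Lemma strip_slope : strip_like -> forall phi, slope K phi = M * `|cos (phi - theta)|.
Proof.
move=> sl phi; rewrite slope_gap.
have := @periodic_reduce _ gap pi 0 (phi - theta) (pi_gt0 R) gap_pi.
by rewrite add0r => -[y yI ->]; rewrite /gap sl // subrr add0r.
Qed.

Lemma dot_geod phi t : dot (geod (tangent_dir phi) t) e = sin t * cos (phi - theta).
Proof. by rewrite geod_dir dot3 !vec3K cosB; ring. Qed.

Lemma body_in_strip x : K x -> M * `|dot x e| <= x 0 2.
Proof.
move=> Kx; have [phi [t [tI xE]]] := polar_coordinates (K_hemi Kx).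
move: Kx; rewrite xE mem_body // rho_slope // -(subrK theta phi) -psi_cos subrK => h.
have := strip_radius_geE M (psi (phi - theta)) tI; rewrite h => /esym.
rewrite dot_geod geod_dir2 => hs.
have st : 0 <= sin t by exact: sin_ge0_pihalf.
rewrite normrM (ger0_norm st) mulrCA mulrC; apply: le_trans hs.
by rewrite ler_wpM2r // psi_cos subrK slope_ge_strip.
Qed.

Lemma strip_in_body : strip_like -> forall x, sphere x -> M * `|dot x e| <= x 0 2 -> K x.
Proof.
move=> sl x sx hx.
have hemi : hemisphere x.
  by split => //; rewrite dot_pole (le_trans _ hx) // mulr_ge0 // ltW.
have [phi [t [tI xE]]] := polar_coordinates hemi.
have st : 0 <= sin t by exact: sin_ge0_pihalf.
move: hx; rewrite xE dot_geod geod_dir2 normrM (ger0_norm st) => h.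
apply/mem_body => //; rewrite rho_slope // -(subrK theta phi) -psi_cos.
rewrite -/(strip_radius M (psi (phi - theta))) strip_radius_geE //.
rewrite psi_cos subrK strip_slope //; move: h; lra.
Qed.

(** Normal of the great circle of points [x] with [x 0 2 = s * M * dot x e]; the
    sides of the strip are on those for [s = 1] and [s = -1]. *)
Definition side_normal (s : R) : 'rV[R]_3 := (s * M) *: e - pole.

Definition side s : set 'rV[R]_3 := hemisphere `&` [set x | dot x (side_normal s) = 0].

Lemma dot_side x s : dot x (side_normal s) = s * M * dot x e - x 0 2.
Proof.
rewrite /side_normal dotC dotDl dotZl -(scaleN1r pole) dotZl (dotC pole) dot_pole (dotC e).
by rewrite mulN1r.
Qed.

Lemma side_normal_neq0 s : side_normal s != 0.
Proof.
apply/eqP => /rowP/(_ 2); rewrite !mxE /= mulr0 add0r => /eqP.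
by rewrite oppr_eq0 oner_eq0.
Qed.

Lemma side_line s : s ^+ 2 = 1 -> geod_line (side s).
Proof.
move=> s2; exists (side_normal s); split=> //; first exact: side_normal_neq0.
pose x : 'rV[R]_3 := cos (atan M) *: vec3 (s * cos theta) (s * sin theta) M.
have c0 := cos_atan_gt0 M.
have x2 : 0 < x 0 2 by rewrite !mxE /= mulr_gt0.
have sx : sphere x.
  have cs := cos2Dsin2 theta.
  have := cos2Dsin2 (atan M).
  have -> : sin (atan M) = cos (atan M) * M.
    by rewrite -{3}(atanK M) /tan mulrC divfK // lt0r_neq0.
  rewrite /sphere /= dot3 !mxE /= => c1.
  transitivity (cos (atan M) ^+ 2 * (s ^+ 2 * (cos theta ^+ 2 + sin theta ^+ 2))
    + (cos (atan M) * M) ^+ 2); first ring.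
  by rewrite s2 cs !mulr1.
exists x; split; last by apply/open_hemisphere.
split; first by split => //; rewrite dot_pole ltW.
rewrite /= dot_side dot3 !mxE /=; have cs := cos2Dsin2 theta.
transitivity (cos (atan M) * M * (s ^+ 2 * (cos theta ^+ 2 + sin theta ^+ 2) - 1)).
  by ring.
by rewrite s2 cs mulr1 subrr mulr0.
Qed.

(** Points of the strip strictly between the sides are interior; a point of a
    side is approached from outside by tilting it along the normal. *)
Lemma strip_lune : strip_like -> lune K.
Proof.
move=> sl; split => //; first by have [] := K_body.
exists (side 1), (side (-1)); split.
- by apply: side_line; rewrite expr1n.
- by apply: side_line; rewrite sqrrN expr1n.
- rewrite /parallel_lines -subset0 => x [[[_ /= h1] [_ /= h2]] /open_hemisphere[_ x2]].
  by move: h1 h2; rewrite !dot_side; lra.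
have sideE x : (side 1 `|` side (-1)) x <-> sphere x /\ M * `|dot x e| = x 0 2.
  split=> [|[sx hx]].
    case=> -[[sx]]; rewrite dot_pole /= dot_side => x2 h; split => //.
      have d0 : 0 <= dot x e by rewrite -(pmulr_rge0 _ M_gt0); lra.
      by rewrite ger0_norm //; lra.
    have d0 : dot x e <= 0 by rewrite -(pmulr_rle0 _ M_gt0); lra.
    by rewrite ler0_norm //; lra.
  have hemi : hemisphere x.
    by split => //; rewrite dot_pole -hx mulr_ge0 // ltW.
  have [d0|d0] := leP 0 (dot x e).
    left; split => //=; rewrite dot_side; move: hx; rewrite ger0_norm //; lra.
  right; split => //=; rewrite dot_side; move: hx; rewrite ltr0_norm //; lra.
apply/seteqP; split=> [x [cKx cx]|x /sideE[sx hx]].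
  have Kx : K x by rewrite (closure_id K).1.
  have [sx _] := K_hemi Kx.
  apply/sideE; split => //; apply/eqP; rewrite eq_le body_in_strip //= leNgt.
  apply/negP => lt.
  have nB : nbhs x ((fun y => dot y pole - M * `|dot y e|) @^-1` [set r | 0 < r]).
    have cont : continuous (fun y : 'rV[R]_3 => dot y pole - M * `|dot y e|).
      move=> y; have c1 := @continuous_dot _ pole y; have c2 := @continuous_dot _ e y.
      exact: (cvgB c1 (cvgM (cvg_cst M) (cvg_norm c2))).
    apply: cont; apply: open_nbhs_nbhs; split; first exact: open_gt.
    by rewrite /= subr_gt0 dot_pole.
  have [y [[sy nKy] /= hy]] := cx _ nB.
  apply: nKy; apply: strip_in_body => //.
  by move: hy; rewrite dot_pole subr_gt0 => /ltW.
have Kx : K x by apply: strip_in_body => //; rewrite hx.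
split; first exact: subset_closure.
move=> B nB.
have [s [s2 xs]] : exists s, s ^+ 2 = 1 :> R /\ dot x (side_normal s) = 0.
  have [d0|d0] := leP 0 (dot x e).
    by exists 1; rewrite expr1n dot_side -hx ger0_norm // mul1r subrr.
  by exists (-1); rewrite sqrrN expr1n dot_side -hx ltr0_norm //; split => //; ring.
have [y [By sy yn]] := tilt sx (side_normal_neq0 s) xs nB.
exists y; split => //; split => //= Ky; move: yn; rewrite dot_side subr_gt0 ltNge.
have := body_in_strip Ky => /(le_trans _) -> //.
rewrite (mulrC s) -mulrA ler_pM2l // (le_trans (ler_norm _)) //.
have s1 : `|s| = 1.
  by apply/eqP; rewrite -(eqrXn2 (n := 2)) // expr1n real_normK ?num_real // s2.
by rewrite normrM s1 ?mulr1 ?mul1r.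
Qed.


(** A lune has a side through the point of the body nearest to the pole on its
    boundary. That side lies in the body, hence between the two lines of the
    strip, one of which it meets there: it has to be this line. *)
Lemma lune_strip : lune K -> strip_like.
Proof.
move=> [_ _ _ [L1 [L2 [line1 line2 _ bdE]]]].
pose p0 := cot_point theta M.
have slM : slope K theta = M by [].
have Kp0 : K p0 by apply/(mem_slope K_body K_sym theta (ltW M_gt0)); rewrite slM.
have rh : rho K theta < pi / 2.
  by rewrite rho_slope // slM gtrBl -(@atan0 R) lt_atan.
have p0E : p0 = geod (tangent_dir theta) (rho K theta).
  by rewrite /p0 /cot_point (rho_slope K_body K_sym theta).
have bd0 : (L1 `|` L2) p0.
  rewrite -bdE; split; first exact: subset_closure.
  move=> B; rewrite p0E => /continuous_geod nB.
  have [d /= d0 hd] := (nbhs_ballP _ _).1 nB.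
  pose s := Num.min d (pi / 2 - rho K theta) / 2.
  have s0 : 0 < s by rewrite divr_gt0 // lt_min d0 subr_gt0.
  have sd : s < d.
    have : Num.min d (pi / 2 - rho K theta) <= d by rewrite ge_min lexx.
    by rewrite /s; lra.
  have sr : rho K theta + s <= pi / 2.
    have : Num.min d (pi / 2 - rho K theta) <= pi / 2 - rho K theta.
      by rewrite ge_min lexx orbT.
    by rewrite /s; move: s0; rewrite /s; lra.
  exists (geod (tangent_dir theta) (rho K theta + s)); split.
    split; first exact: geod_sphere.
    have r0 := rho_gt0 K_body K_sym theta.
    rewrite /= mem_body //; first by rewrite gerDl leNgt s0.
    by rewrite sr andbT addr_ge0 // ltW.
  by apply: hd; rewrite /ball /= opprD addNKr normrN gtr0_norm.
have [L [lineL Lp0 LK]] : exists L, [/\ geod_line L, L p0 & L `<=` K].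
  have bK : sph_boundary K `<=` K by move=> x [+ _]; rewrite -(closure_id K).1.
  by case: bd0 => h; [exists L1|exists L2]; split => // x Lx; apply: bK;
    rewrite bdE; [left|right].
case: lineL => n [n0 LE _].
pose nu := - side_normal 1.
have dot_nu x : dot x nu = x 0 2 - M * dot x e.
  by rewrite /nu -scaleN1r dotC dotZl dotC dot_side mul1r; ring.
have LnuE x : K x -> 0 <= dot x nu.
  move=> Kx; rewrite dot_nu subr_ge0; apply: le_trans (body_in_strip Kx).
  by rewrite ler_pM2l // ler_norm.
have cM := cos_atan_gt0 M.
have p02 : 0 < p0 0 2 by rewrite /p0 cot_pointE !mxE /= mulr_gt0.
have p0nu : dot p0 nu = 0.
  rewrite dot_nu /p0 cot_pointE dotZl dot3 !mxE /=.
  have cs := cos2Dsin2 theta.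
  transitivity (cos (atan M) * M * (1 - (cos theta ^+ 2 + sin theta ^+ 2))); first ring.
  by rewrite cs subrr mulr0.
have p0n : dot p0 n = 0 by move: Lp0; rewrite LE => -[].
(* normalising a vector of the plane of [L] above the equator *)
have cone x : 0 < x 0 2 -> dot x n = 0 -> 0 <= dot x nu.
  move=> x2 xn; have x0 : x != 0.
    by apply: contraTneq x2 => ->; rewrite mxE ltxx.
  have xx := dot_gt0 x0.
  pose k := (Num.sqrt (dot x x))^-1.
  have k0 : 0 < k by rewrite invr_gt0 sqrtr_gt0.
  have Lx : L (k *: x).
    rewrite LE; split; last by rewrite /= dotZl xn mulr0.
    split; last by rewrite dot_pole mxE mulr_ge0 ?ltW.
    rewrite /sphere /= dotZl dotC dotZl mulrA -expr2 exprVn sqr_sqrtr ?ltW //.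
    by rewrite mulVf // lt0r_neq0.
  by have := LnuE _ (LK _ Lx); rewrite dotZl pmulr_rge0.
have plane v : dot v n = 0 -> dot v nu = 0.
  move=> vn.
  (* from [p0] one can move a little along [w] without reaching the equator *)
  have half w : dot w n = 0 -> 0 <= dot w nu.
    move=> wn; pose s := p0 0 2 / (1 + `|w 0 2|).
    have q0 : 0 < 1 + `|w 0 2| by rewrite ltr_wpDr.
    have s0 : 0 < s by rewrite divr_gt0.
    have := cone (p0 + s *: w).
    rewrite !(dotDl p0) !(dotZl s w) p0n wn p0nu mulr0 addr0 add0r pmulr_rge0 // => -> //.
    rewrite mxE [X in _ + X]mxE.
    have h1 : s * - w 0 2 <= s * `|w 0 2| by rewrite ler_pM2l // ler_normr lexx orbT.
    have h2 : p0 0 2 = s + s * `|w 0 2|.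
      by rewrite -{1}(divfK (lt0r_neq0 q0) (p0 0 2)) -/s; ring.
    by rewrite h2; lra.
  apply/eqP; rewrite eq_le half // andbT.
  have := half (- v); rewrite -scaleN1r !dotZl vn mulr0 => /(_ erefl).
  by rewrite mulN1r oppr_ge0.
have nn := dot_gt0 n0.
pose k := dot nu n / dot n n.
have nuE : nu = k *: n.
  apply/eqP; rewrite -subr_eq0; apply/eqP; apply: dot_eq0.
  set v := nu - _.
  have vn : dot v n = 0.
    by rewrite /v -scaleN1r dotDl !dotZl /k divfK ?lt0r_neq0 // mulN1r subrr.
  have vE : v = nu + (- k) *: n by rewrite /v scaleNr.
  by rewrite {2}vE dotC dotDl dotZl (dotC n) vn (dotC nu) plane // mulr0 addr0.
have k0 : k != 0.
  apply/eqP => kz; have := side_normal_neq0 1.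
  by rewrite -oppr_eq0 -/nu nuE kz scale0r eqxx.
(* so the side is the line of the strip, and it lies in the body *)
have below phi : 0 <= cos (phi - theta) -> slope K phi <= M * cos (phi - theta).
  move=> c0; have q0 : 0 <= M * cos (phi - theta) by rewrite mulr_ge0 // ltW.
  apply/mem_slope => //; apply: LK; rewrite LE; split; first exact: cot_point_hemisphere.
  rewrite /=; apply: (mulfI k0); rewrite mulr0 dotC -dotZl -nuE dotC dot_nu.
  by rewrite cot_pointE dotZl dot3 !mxE /= cosB; ring.
move=> u uI; apply: (mulfI (lt0r_neq0 M_gt0)); rewrite psi_cos.
apply/eqP; rewrite eq_le.
have := slope_ge_strip (u + theta); rewrite addrK => ->; rewrite andbT.
have [c0|c0] := leP 0 (cos u).
  by rewrite ger0_norm //; have := below (u + theta); rewrite addrK; exact.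
rewrite ltr0_norm // -(slopeDpi K_sym); have := below (u + theta + pi).
rewrite addrAC addrK cosDpi => -> //; rewrite oppr_ge0; exact: ltW.
Qed.

End Lune.

Unset Implicit Arguments.

Theorem theorem5p3 (R : realType) (K : set 'rV[R]_3)
  (K_body : convex_body K) (K_sym : origin_symmetric K)
  (K_neq : K <> hemisphere) :
  let lhs : \bar R :=
    circle_integral (fun xi => line_length xi (K `&` perp xi) ^+ 2)%E in
  let rhs : \bar R :=
    (16%:E * \int[lebesgue_measure]_(theta in `[0%R, (pi / 2)%R])
       ((atan (tan (fine (area K) / 4) / cos theta)) ^+ 2)%:E)%E in
  (lhs <= rhs)%E /\ (lhs = rhs <-> lune K).
Proof.
move=> lhs rhs.
have [theta theta_itv theta_max] := slope_max K_body K_sym.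
pose M := max_slope K theta; pose f := body_angle K theta.
have M_gt0 : 0 < M by exact: max_slope_gt0.
have f_lip : forall x y, `|f x - f y| <= `|x - y| by exact: body_angle_lipschitz.
have f_itv : forall x, 0 <= f x <= pi / 2 by exact: body_angle_itv.
have f_0 : f 0 = 0 by exact: body_angle0.
have f_pi : f pi = 0 by exact: body_anglepi.
have angleE : fine (area K) / 4 = lune_angle M f.
  rewrite (area_body K_body K_sym K_neq theta_itv theta_max) /lune_angle /= -/M -/f.
  by field.
have lhsE : lhs = (8 * body_square M f)%:E by exact: chord_square_body.
have rhsE : rhs = (8 * strip_square (lune_slope M f))%:E.
  rewrite /rhs angleE integral_lune; last exact: lune_angle_itv.
  by rewrite -EFinM /strip_square mulrA; congr (_ * _)%:E; ring.
rewrite lhsE rhsE; split.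
  by rewrite lee_fin ler_pM2l // radial_inequality.
have inj : (8 * body_square M f)%:E = (8 * strip_square (lune_slope M f))%:E <->
    body_square M f = strip_square (lune_slope M f).
  split=> [[]|->//]; exact: mulfI.
rewrite inj radial_equality //; split.
- exact: strip_lune.
- exact: lune_strip.
Qed.
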